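(* Let $\mathcal N$ be a finite and locally irreducible abelian network with total alphabet $A$, total kernel $K$ and production matrix $P$, and let $\mathcal G:=\mathbb Z^A/(I-P)K$, where $I$ is the $A\times A$ identity matrix. Then $\mathcal G$ is isomorphic to the Grothendieck group of the shift monoid $\mathscr M(\mathcal N)$, and the torsion part of $\mathcal G$ (identified with the torsion group $\mathrm{Tor}(\mathcal N)$ of that Grothendieck group) acts freely on the set $\overline{\mathrm{Rec}}(\mathcal N)^\times$ of invertible recurrent components of the trajectory digraph of $\mathcal N$.
   Context: Abelian networks. $\mathbb N=\{0,1,2,\dots\}$. Let $G=(V,E)$ be a finite directed graph (self-loops and multiple edges allowed). An abelian network $\mathcal N$ on $G$ assigns to each $v\in V$ a nonempty input alphabet $A_v$ and a nonempty state space $Q_v$ (the $A_v$ pairwise disjoint), maps $T_a:Q_v\to Q_v$ for $a\in A_v$, and, for each edge $e$ from $v$ to $u$, a message-passing function $T_e:Q_v\times A_v\to A_u^*$ (free monoid of words), such that for all $v$, $a,b\in A_v$, $q\in Q_v$: $T_aT_b=T_bT_a$, and for every edge $e$ out of $v$ the words $T_e(q,a)T_e(T_a(q),b)$ and $T_e(q,b)T_e(T_b(q),a)$ agree up to permuting letters. Put $A=\bigsqcup_v A_v$, $Q=\prod_v Q_v$; $\mathcal N$ is finite if $A$ and $Q$ are finite. For a word $w\in A^*$, $|w|\in\mathbb N^A$ counts the occurrences of each letter. For $a\in A_v$, $\mathbf q\in Q$: $t_a\mathbf q$ is $\mathbf q$ with $\mathbf q(v)$ replaced by $T_a(\mathbf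 q(v))$, and $\mathbf M_a(\mathbf q)=\sum_{e\text{ out of }v}|T_e(\mathbf q(v),a)|\in\mathbb N^A$. A configuration is a pair $\mathbf x.\mathbf q$ with $\mathbf x\in\mathbb Z^A$, $\mathbf q\in Q$; $\pi_a(\mathbf x.\mathbf q)=(\mathbf x+\mathbf M_a(\mathbf q)-|a|).t_a\mathbf q$. For $w=a_1\cdots a_\ell$: $t_w=t_{a_\ell}\cdots t_{a_1}$, $\mathbf M_w(\mathbf q)=\sum_i\mathbf M_{a_i}(t_{a_1\cdots a_{i-1}}\mathbf q)$, $\pi_w=\pi_{a_\ell}\cdots\pi_{a_1}$; these depend only on $|w|$, so $t_{\mathbf n},\mathbf M_{\mathbf n},\pi_{\mathbf n}$ are defined for $\mathbf n\in\mathbb N^A$. The word $w$ is legal for $\mathbf x.\mathbf q$ if, with $\mathbf x_i.\mathbf q_i=\pi_{a_1\cdots a_i}(\mathbf x.\mathbf q)$, $\mathbf x_{i-1}(a_i)\ge1$ for all $1\le i\le\ell$. Write $\mathbf x.\mathbf q\xrightarrow{w}\mathbf x'.\mathbf q'$ if $w$ is legal for $\mathbf x.\mathbf q$ and $\pi_w(\mathbf x.\mathbf q)=\mathbf x'.\mathbf q'$; write $\mathbf x.\mathbf q\to\mathbf x'.\mathbf q'$ if this holds for some (possibly empty) $w$. Local recurrence, kernel, production matrix. $\mathcal N$ is locally irreducible if for all $\mathbf q,\mathbf q'\in Q$ there are words $w,w'$ with $t_w\mathbf q=t_{w'}\mathbf q'$. For $\mathcal N$ finite, let $e$ be the product of all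 idempotents of the finite commutative monoid generated by the $t_a$ in $\mathrm{End}(Q)$; $\mathrm{Loc}(\mathcal N)=eQ$ is the set of locally recurrent states. The total kernel is $K=\{\mathbf z\in\mathbb Z^A: t_{\mathbf z^+}\mathbf q=t_{\mathbf z^-}\mathbf q\ \forall\mathbf q\in\mathrm{Loc}(\mathcal N)\}$, with $\mathbf z^{\pm}\in\mathbb N^A$ the positive/negative parts of $\mathbf z$; it is a finite-index subgroup of $\mathbb Z^A$. For $\mathcal N$ finite and locally irreducible, the production matrix $P$ is the unique rational $A\times A$ matrix with $P\mathbf k=\mathbf M_{\mathbf k}(\mathbf q)$ for all $\mathbf k\in K\cap\mathbb N^A$ and $\mathbf q\in\mathrm{Loc}(\mathcal N)$ (it exists and does not depend on $\mathbf q$). Components. The trajectory digraph has the configurations as vertices and an $a$-labelled edge $\mathbf x.\mathbf q\to\mathbf x'.\mathbf q'$ whenever $\mathbf x.\mathbf q\xrightarrow{a}\mathbf x'.\mathbf q'$, $a\in A$. Two configurations are legally related if there is $\mathbf x_3.\mathbf q_3$ with $\mathbf x_1.\mathbf q_1\to\mathbf x_3.\mathbf q_3$ and $\mathbf x_2.\mathbf q_2\to\mathbf x_3.\mathbf q_3$ (an equivalence relation). A component of the trajectory digraph is an equivalence class of this relation (with the induced subgraph); $\overline{\mathbf x.\mathbf q}$ is the component of $\mathbf x.\mathbf q$. An infinite walk is a sequence of configurations $\mathbf x_i.\mathbf q_i$ and letters $a_i$ with $\mathbf x_{i-1}.\mathbf q_{i-1}\xrightarrow{a_i}\mathbf x_i.\mathbf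 q_i$ for consecutive indices in $I$, where $I$ is $\mathbb Z_{\le0}$, $\mathbb Z_{\ge0}$ or $\mathbb Z$; it is diverse if each letter $a\in A$ equals $a_i$ for infinitely many $i$. A component is recurrent if it contains a diverse infinite walk. $\overline{\mathrm{Rec}}(\mathcal N)$ is the set of recurrent components. Shift monoid and torsion group. $\mathbb N^A$ acts on $\overline{\mathrm{Rec}}(\mathcal N)$ by $\phi(\mathbf n)(\overline{\mathbf x.\mathbf q})=\overline{(\mathbf x+\mathbf n).\mathbf q}$; the shift monoid is $\mathscr M(\mathcal N)=\phi(\mathbb N^A)\subseteq\mathrm{End}(\overline{\mathrm{Rec}}(\mathcal N))$. $\mathscr K(\mathcal N)$ is the Grothendieck group of this commutative monoid (classes $\overline{(m,m')}$ of pairs, $(m_1,m_1')\sim(m_2,m_2')$ iff $mm_1m_2'=mm_1'm_2$ for some $m$), and $\mathrm{Tor}(\mathcal N)$ is the torsion subgroup of $\mathscr K(\mathcal N)$. A recurrent component $\overline{\mathbf x.\mathbf q}$ is invertible if for every $g\in\mathrm{Tor}(\mathcal N)$ there is a recurrent component $\overline{\mathbf x'.\mathbf q'}$ such that $\overline{(\mathbf x+\mathbf n).\mathbf q}=\overline{(\mathbf x'+\mathbf n').\mathbf q'}$ for all $\mathbf n,\mathbf n'\in\mathbb N^A$ with $g=\overline{(\phi(\mathbf n),\phi(\mathbf n'))}$; $\overline{\mathrm{Rec}}(\mathcal N)^\times$ is the set of invertible ones, and $\mathrm{Tor}(\mathcal N)$ acts on it by $g\cdot\overline{\mathbf x.\mathbf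 q}=\overline{\mathbf x'.\mathbf q'}$. An action of a group or monoid is free if $mx=m'x$ for some $x$ implies $m=m'$. *)

(* Defs.v *)
From HB Require Import structures.
From mathcomp Require Import all_boot all_order all_algebra.
From mathcomp Require Import zify boolp.

Set Implicit Arguments.
Unset Strict Implicit.
Unset Printing Implicit Defensive.

Import Order.TTheory GRing.Theory Num.Theory.

Local Open Scope ring_scope.
Local Open Scope quotient_scope.

(* A finite directed graph is given by its finite vertex type V and the finite
   types E v u of edges from v to u, so self-loops and multiple edges are
   allowed. The finiteness of the network is built in: alphabets and state
   spaces are finTypes. *)
Record finite_abelian_network (V : finType) (E : V -> V -> finType) :=
  FiniteAbelianNetwork {
  alphabet : V -> finType;
  state : V -> finType;
  alphabet_gt0 : forall v, (0 < #|alphabet v|)%N;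
  state_gt0 : forall v, (0 < #|state v|)%N;
  trans : forall v, alphabet v -> state v -> state v;
  msg : forall v u, E v u -> state v -> alphabet v -> seq (alphabet u);
  transC : forall v (a b : alphabet v) (q : state v),
    trans a (trans b q) = trans b (trans a q);
  msgC : forall v u (e : E v u) (a b : alphabet v) (q : state v),
    perm_eq (msg e q a ++ msg e (trans a q) b)
            (msg e q b ++ msg e (trans b q) a)
}.

Section Dynamics.
Context (V : finType) (E : V -> V -> finType) (N : finite_abelian_network E).

(* The total alphabet is a disjoint union by construction. *)
Definition letter : finType := {v : V & alphabet N v}.
Definition states : finType := {dffun forall v : V, state N v}.
Definition word := seq letter.
Definition vecN := {ffun letter -> nat}.
Definition vecZ := {ffun letter -> int}.

Definition to_vecZ (n : vecN) : vecZ := [ffun a => (n a)%:Z].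

Definition parikh (w : word) : vecN := [ffun a => count_mem a w].

(* t_a on total states; dfwith only changes the coordinate of the vertex of a. *)
Definition t1 (a : letter) (q : states) : states :=
  [ffun v => dfwith q (trans (tagged a) (q (tag a))) v].

Definition M1 (a : letter) (q : states) : vecN :=
  \sum_(u : V) \sum_(e : E (tag a) u)
    parikh [seq Tagged (fun v => alphabet N v) b
           | b <- msg e (q (tag a)) (tagged a)].

Fixpoint tw (w : word) (q : states) : states :=
  if w is a :: w' then tw w' (t1 a q) else q.

Fixpoint Mw (w : word) (q : states) : vecN :=
  if w is a :: w' then M1 a q + Mw w' (t1 a q) else 0.

(* t_w and M_w depend only on |w|, so for n in N^A any word with Parikh vector
   n may be used; see tn_parikh and Mn_parikh below. *)
Definition word_of (n : vecN) : word :=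
  flatten [seq nseq (n a) a | a <- enum letter].

Definition tn (n : vecN) : states -> states := tw (word_of n).
Definition Mn (n : vecN) : states -> vecN := Mw (word_of n).

Definition config : Type := (vecZ * states)%type.

Definition fire (a : letter) (c : config) : config :=
  (c.1 + to_vecZ (M1 a c.2) - to_vecZ (parikh [:: a]), t1 a c.2).

Fixpoint exec (w : word) (c : config) : config :=
  if w is a :: w' then exec w' (fire a c) else c.

Fixpoint legal (w : word) (c : config) : bool :=
  if w is a :: w' then (1 <= c.1 a) && legal w' (fire a c) else true.

Definition leads_by (w : word) (c c' : config) : Prop :=
  legal w c /\ exec w c = c'.

Definition leads (c c' : config) : Prop := exists w, leads_by w c c'.

Definition legally_related (c1 c2 : config) : Prop :=
  exists c3, leads c1 c3 /\ leads c2 c3.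

Lemma word_ofK n : parikh (word_of n) = n.
Proof.
apply/ffunP=> a; rewrite ffunE /word_of count_flatten -map_comp sumnE big_map.
rewrite big_enum /= (bigD1 a) //= count_nseq /= eqxx mul1n big1 ?addn0 //.
by move=> b /negbTE nba; rewrite count_nseq /= nba.
Qed.

Lemma parikh_perm w w' : parikh w = parikh w' -> perm_eq w w'.
Proof.
move=> e; apply/allP=> a _ /=.
by move/ffunP: e => /(_ a); rewrite !ffunE => ->.
Qed.

Lemma perm_parikh w w' : perm_eq w w' -> parikh w = parikh w'.
Proof. by move=> /permP e; apply/ffunP=> a; rewrite !ffunE e. Qed.

Lemma parikh_cat w w' : parikh (w ++ w') = parikh w + parikh w'.
Proof. by apply/ffunP=> a; rewrite !ffunE count_cat. Qed.

Lemma t1E_in a q : t1 a q (tag a) = trans (tagged a) (q (tag a)).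
Proof. by rewrite ffunE dfwith_in. Qed.

Lemma t1E_out a q v : tag a != v -> t1 a q v = q v.
Proof. by move=> ?; rewrite ffunE dfwith_out. Qed.

Lemma t1C a b q : t1 a (t1 b q) = t1 b (t1 a q).
Proof.
have [ab|ab] := eqVneq (tag a) (tag b).
  case: a b ab => [v a] [u b] /= e; case: u / e b => b.
  have tE c q' : t1 (existT _ v c) q' v = trans c (q' v).
    exact: t1E_in (existT _ v c) q'.
  apply/ffunP=> u; have [<-|vu] := eqVneq v u; first by rewrite !tE transC.
  by rewrite !t1E_out.
apply/ffunP=> v; have [<-|av] := eqVneq (tag a) v.
  by rewrite t1E_in !(t1E_out (a := b)) 1?eq_sym // t1E_in.
rewrite (t1E_out _ av); have [<-|bv] := eqVneq (tag b) v; last first.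
  by rewrite !t1E_out.
by rewrite !t1E_in t1E_out.
Qed.

Lemma M1C a b q : M1 a q + M1 b (t1 a q) = M1 b q + M1 a (t1 b q).
Proof.
have [ab|ab] := eqVneq (tag a) (tag b); last first.
  by rewrite /M1 !t1E_out // 1?eq_sym // addrC.
case: a b ab => [v a] [u b] /= e; case: u / e b => b.
rewrite /M1 -!big_split /=; apply: eq_bigr => u _.
rewrite -!big_split /=; apply: eq_bigr => e _.
rewrite (t1E_in (existT _ v a)) (t1E_in (existT _ v b)) /=.
rewrite -!parikh_cat -!map_cat; apply: perm_parikh.
exact/perm_map/msgC.
Qed.

Lemma tw_cat w w' q : tw (w ++ w') q = tw w' (tw w q).
Proof. by elim: w q => //= a w IH q; rewrite IH. Qed.

Lemma Mw_cat w w' q : Mw (w ++ w') q = Mw w q + Mw w' (tw w q).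
Proof. by elim: w q => [|a w IH] q /=; rewrite ?add0r // IH addrA. Qed.

Lemma tw_rot a w q : tw w (t1 a q) = t1 a (tw w q).
Proof. by elim: w q => //= b w IH q; rewrite t1C IH. Qed.

Lemma Mw_rot a w q : M1 a q + Mw w (t1 a q) = Mw w q + M1 a (tw w q).
Proof.
elim: w q => [|b w IH] q /=; first by rewrite addr0 add0r.
by rewrite addrA M1C -addrA t1C IH addrA.
Qed.

Lemma tMw_perm w w' q : perm_eq w w' -> tw w q = tw w' q /\ Mw w q = Mw w' q.
Proof.
elim: w w' q => [|a w IH] w' q.
  by rewrite perm_sym => /perm_nilP->.
move=> e; have: a \in w' by rewrite -(perm_mem e) mem_head.
move/splitPr=> sw; case: sw e => p1 p2.
rewrite perm_sym -cat1s perm_catCA perm_cons perm_sym.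
move=> /(IH _ (t1 a q)) [et eM] /=; rewrite et eM !tw_cat !Mw_cat /= tw_rot.
by split=> //; rewrite !addrA Mw_rot.
Qed.

Lemma tn_parikh w : tn (parikh w) = tw w.
Proof.
apply/funext=> q; rewrite /tn.
by have [] := @tMw_perm (word_of (parikh w)) w q (parikh_perm (word_ofK _)).
Qed.

Lemma Mn_parikh w : Mn (parikh w) = Mw w.
Proof.
apply/funext=> q; rewrite /Mn.
by have [] := @tMw_perm (word_of (parikh w)) w q (parikh_perm (word_ofK _)).
Qed.

Lemma to_vecZD m n : to_vecZ (m + n) = to_vecZ m + to_vecZ n.
Proof. by apply/ffunP=> a; rewrite !ffunE /= -PoszD. Qed.

Lemma fireC a b c : fire a (fire b c) = fire b (fire a c).
Proof.
rewrite /fire /= t1C; congr pair.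
have shuffle (x u p v r : vecZ) : x + u - p + v - r = x + (u + v) - (p + r).
  by rewrite opprD !addrA [x + u - p + v]addrAC.
by rewrite !shuffle -!to_vecZD M1C [parikh [:: b] + _]addrC.
Qed.

Lemma fire_ge a b (c : config) : a != b -> c.1 a <= (fire b c).1 a.
Proof.
move=> /negbTE ab; rewrite !ffunE /= addn0 [b == a]eq_sym ab subr0.
by rewrite lerDl.
Qed.

Lemma legal_cat w w' c : legal (w ++ w') c = legal w c && legal w' (exec w c).
Proof. by elim: w c => //= a w IH c; rewrite IH andbA. Qed.

Lemma exec_cat w w' c : exec (w ++ w') c = exec w' (exec w c).
Proof. by elim: w c => //= a w IH c. Qed.

Lemma leads_refl c : leads c c.
Proof. by exists [::]. Qed.

Lemma leads_trans c2 c1 c3 : leads c1 c2 -> leads c2 c3 -> leads c1 c3.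
Proof.
move=> [w [l e]] [w' [l' e']]; exists (w ++ w').
by split; rewrite ?legal_cat ?exec_cat e // l.
Qed.

Lemma leads_strip a w (c : config) : 1 <= c.1 a -> legal w c ->
  exists2 d, leads (exec w c) d & leads (fire a c) d.
Proof.
elim: w c => [|b w IH] c ca /=.
  by move=> _; exists (fire a c); [exists [:: a]; rewrite /leads_by /= ca|exact: leads_refl].
move=> /andP[cb lw]; have [ab|ab] := eqVneq a b.
  exists (exec w (fire b c)); first exact: leads_refl.
  by exists w; rewrite ab.
have [d h1 h2] := IH _ (le_trans ca (fire_ge c ab)) lw.
exists d => //; apply: leads_trans h2; exists [:: b]; rewrite /leads_by /= fireC.
by rewrite (le_trans cb) //; apply: fire_ge; rewrite eq_sym.
Qed.

Lemma leads_confluent c c1 c2 : leads c c1 -> leads c c2 ->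
  legally_related c1 c2.
Proof.
move=> [w [+ <-]]; elim: w c c2 => [|a w IH] c c2 /=.
  by move=> _ ?; exists c2; split=> //; exact: leads_refl.
move=> /andP[ca lw] [w' [lw' <-]].
have [d h1 h2] := leads_strip ca lw'.
have [d' [h3 h4]] := IH _ _ lw h2.
by exists d'; split=> //; apply: leads_trans h4.
Qed.

Definition legal_rel (c1 c2 : config) : bool := `[< legally_related c1 c2 >].

Lemma legal_rel_equiv : equiv_class_of legal_rel.
Proof.
split=> [c|c1 c2|c2 c1 c3].
- by apply/asboolP; exists c; split; exact: leads_refl.
- by apply: asbool_equiv_eq; split=> -[d [? ?]]; exists d.
- move=> /asboolP[d [h1 h2]] /asboolP[d' [h3 h4]]; apply/asboolP.
  have [e [h5 h6]] := leads_confluent h2 h3.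
  by exists e; split; [exact: leads_trans h5|exact: leads_trans h6].
Qed.

Canonical legal_rel_equiv_rel := EquivRelPack legal_rel_equiv.
Canonical legal_rel_encModRel := defaultEncModRel legal_rel.

Definition component := {eq_quot legal_rel}.
HB.instance Definition _ := EqQuotient.on component.
HB.instance Definition _ := Choice.on component.

Definition component_of (c : config) : component := \pi_component c.

Lemma component_ofP c1 c2 :
  component_of c1 = component_of c2 <-> legally_related c1 c2.
Proof. by split=> [/eqmodP/asboolP|?] //; apply/eqmodP/asboolP. Qed.

Variant walk_domain : (int -> bool) -> Prop :=
| WalkNonpos : walk_domain (fun i => i <= 0)
| WalkNonneg : walk_domain (fun i => 0 <= i)
| WalkAll : walk_domain (fun=> true).

(* The values of c and a at indices outside I, and that of a at the least index
   of I, are irrelevant. *)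
Definition infinite_walk (I : int -> bool) (c : int -> config)
    (a : int -> letter) : Prop :=
  walk_domain I /\
  forall i : int, I (i - 1) -> I i -> leads_by [:: a i] (c (i - 1)) (c i).

(* A set of integers is infinite iff it contains integers of arbitrarily large
   absolute value. *)
Definition diverse (I : int -> bool) (a : int -> letter) : Prop :=
  forall (b : letter) (n : nat), exists i : int, [/\ I i, (n <= `|i|)%N & a i = b].

Definition recurrent (C : component) : Prop :=
  exists I c a, [/\ infinite_walk I c a, diverse I a &
    forall i, I i -> component_of (c i) = C].

Definition rec_component := {C : component | `[< recurrent C >]}.

Definition shift_config (n : vecN) (c : config) : config :=
  (c.1 + to_vecZ n, c.2).

Lemma fire_shift n a c : fire a (shift_config n c) = shift_config n (fire a c).
Proof.
rewrite /fire /shift_config /=; congr pair.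
by rewrite [c.1 + _ + _]addrAC [_ + to_vecZ n - _]addrAC.
Qed.

Lemma leads_by_shift n w c c' :
  leads_by w c c' -> leads_by w (shift_config n c) (shift_config n c').
Proof.
move=> [+ <-]; elim: w c => [|a w IH] c //= /andP[ca lw].
rewrite /leads_by /= !fire_shift; have [-> ->] := IH _ lw.
by rewrite !ffunE /= (le_trans ca) // lerDl.
Qed.

Lemma related_shift n c1 c2 : legally_related c1 c2 ->
  legally_related (shift_config n c1) (shift_config n c2).
Proof.
by move=> [d [[w h] [w' h']]]; exists (shift_config n d); split;
  [exists w|exists w']; exact: leads_by_shift.
Qed.

Definition shift_component (n : vecN) (C : component) : component :=
  component_of (shift_config n (repr C)).

Lemma shift_component_of n c :
  shift_component n (component_of c) = component_of (shift_config n c).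
Proof. by apply/component_ofP/related_shift/component_ofP; rewrite /component_of reprK. Qed.

Lemma shift_recurrent n (C : rec_component) :
  `[< recurrent (shift_component n (val C)) >].
Proof.
case: C => C /= /asboolP [I [c [a [[dI wI] dv h]]]]; apply/asboolP.
exists I, (shift_config n \o c), a; split=> //.
- by split=> // i h1 h2; apply/leads_by_shift/wI.
- by move=> i Ii; rewrite -(h _ Ii) shift_component_of.
Qed.

Definition phi (n : vecN) (C : rec_component) : rec_component :=
  exist _ (shift_component n (val C)) (shift_recurrent n C).

Lemma phi0 : phi 0 = id.
Proof.
apply/funext=> C; apply: val_inj => /=; rewrite -[val C]reprK.
rewrite shift_component_of; congr component_of.
rewrite /shift_config; case: (repr _) => x q /=; congr pair.
by apply/ffunP=> a; rewrite !ffunE addr0.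
Qed.

Lemma phiD m n : phi (m + n) = phi m \o phi n.
Proof.
apply/funext=> C; apply: val_inj => /=; rewrite -[val C]reprK.
rewrite !shift_component_of; congr component_of.
by rewrite reprK /shift_config /= to_vecZD [to_vecZ m + _]addrC addrA.
Qed.

Definition in_shift_monoid (f : rec_component -> rec_component) : bool :=
  `[< exists n, f = phi n >].

Definition shift_monoid := {f : rec_component -> rec_component | in_shift_monoid f}.

Definition shift_monoid_of (n : vecN) : shift_monoid :=
  exist _ (phi n) (asboolT (ex_intro _ n erefl)).

Lemma comp_in_shift_monoid (f g : shift_monoid) :
  in_shift_monoid (val f \o val g).
Proof.
case: f g => _ /= /asboolP[m ->] [_ /= /asboolP[n ->]].
by apply/asboolP; exists (m + n); rewrite phiD.
Qed.

Definition shift_comp (f g : shift_monoid) : shift_monoid :=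
  exist _ (val f \o val g) (comp_in_shift_monoid f g).

Lemma shift_compA : associative shift_comp.
Proof. by move=> f g h; apply: val_inj. Qed.

Lemma shift_compC : commutative shift_comp.
Proof.
move=> [f hf] [g hg]; apply: val_inj => /=.
by move: hf hg => /asboolP[m ->] /asboolP[n ->]; rewrite -!phiD addrC.
Qed.

Lemma shift_comp0 : left_id (shift_monoid_of 0) shift_comp.
Proof. by move=> f; apply: val_inj; rewrite /= phi0. Qed.

HB.instance Definition _ := Choice.on shift_monoid.
(* The addition of the commutative monoid shift_monoid is composition. *)
HB.instance Definition _ :=
  GRing.isNmodule.Build shift_monoid shift_compA shift_compC shift_comp0.

Definition locally_irreducible : Prop :=
  forall q q' : states, exists w w' : word, tw w q = tw w' q'.

Definition End_states : finType := {ffun states -> states}.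
Definition end_comp (f g : End_states) : End_states := [ffun q => f (g q)].
Definition end_id : End_states := [ffun q => q].

Definition transition_monoid : {set End_states} :=
  [set f : End_states | `[< exists w, f = [ffun q => tw w q] >]].

Definition idempotents : {set End_states} :=
  [set f in transition_monoid | end_comp f f == f].

(* The idempotents commute with each other, so the order of the product is
   irrelevant. *)
Definition min_idempotent : End_states :=
  \big[end_comp/end_id]_(f in idempotents) f.

Definition Loc : {set states} := [set min_idempotent q | q : states].

Definition pos_part (z : vecZ) : vecN := [ffun a => `|Num.max (z a) 0|%N].
Definition neg_part (z : vecZ) : vecN := [ffun a => `|Num.max (- z a) 0|%N].

Definition total_kernel : {pred vecZ} :=
  [pred z : vecZ | [forall q in Loc, tn (pos_part z) q == tn (neg_part z) q]].

Lemma tnD m n q : tn (m + n) q = tn m (tn n q).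
Proof.
by rewrite addrC -[m]word_ofK -[n]word_ofK -parikh_cat !tn_parikh tw_cat.
Qed.

Lemma tn0 q : tn 0 q = q.
Proof.
have -> : (0 : vecN) = parikh [::] by apply/ffunP=> a; rewrite !ffunE.
by rewrite tn_parikh.
Qed.

Lemma MnD m n q : Mn (m + n) q = Mn m q + Mn n (tn m q).
Proof.
by rewrite -[m]word_ofK -[n]word_ofK -parikh_cat !Mn_parikh Mw_cat tn_parikh.
Qed.

Lemma tnC m n q : tn m (tn n q) = tn n (tn m q).
Proof. by rewrite -!tnD addrC. Qed.

Lemma tn_in_monoid n : [ffun q => tn n q] \in transition_monoid.
Proof. by rewrite inE; apply/asboolP; exists (word_of n). Qed.

Lemma transition_monoidP f : f \in transition_monoid ->
  exists n, f = [ffun q => tn n q].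
Proof.
rewrite inE => /asboolP[w ->]; exists (parikh w).
by apply/ffunP=> q; rewrite !ffunE tn_parikh.
Qed.

Lemma end_compA : associative end_comp.
Proof. by move=> f g h; apply/ffunP=> q; rewrite !ffunE. Qed.

Lemma end_compC f g : f \in transition_monoid -> g \in transition_monoid ->
  end_comp f g = end_comp g f.
Proof.
move=> /transition_monoidP[m ->] /transition_monoidP[n ->].
by apply/ffunP=> q; rewrite !ffunE tnC.
Qed.

Lemma min_idempotent_in : min_idempotent \in transition_monoid.
Proof.
rewrite /min_idempotent; elim/big_ind: _ => [|f g|f].
- by rewrite inE; apply/asboolP; exists [::].
- move=> /transition_monoidP[m ->] /transition_monoidP[n ->].
  rewrite (_ : end_comp _ _ = [ffun q => tn (m + n) q]) ?tn_in_monoid //.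
  by apply/ffunP=> q; rewrite !ffunE tnD.
- by rewrite inE => /andP[].
Qed.

Lemma min_idempotent_absorb f : f \in idempotents ->
  end_comp f min_idempotent = min_idempotent.
Proof.
rewrite /min_idempotent -big_filter => fI.
set s := [seq _ <- _ | _].
have : f \in s by rewrite mem_filter fI mem_index_enum.
have : {subset s <= idempotents} by move=> g; rewrite mem_filter => /andP[].
elim: s => //= g s IH sI; rewrite inE big_cons => /orP[/eqP fg|fs].
  by rewrite end_compA -fg; move: fI; rewrite inE => /andP[_ /eqP ->].
have [] : g \in transition_monoid /\ f \in transition_monoid.
  by move: (sI _ (mem_head _ _)) fI; rewrite !inE => /andP[-> _] /andP[-> _].
move=> gT fT; rewrite end_compA (end_compC fT gT) -end_compA IH //.
by move=> h hs; apply: sI; rewrite inE hs orbT.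
Qed.

Lemma min_idempotentK : end_comp min_idempotent min_idempotent = min_idempotent.
Proof.
rewrite {1}/min_idempotent; elim/big_ind: _.
- by apply/ffunP=> q; rewrite !ffunE.
- by move=> f g hf hg; rewrite -end_compA hg.
- exact: min_idempotent_absorb.
Qed.

Lemma min_idempotent_Loc q : q \in Loc -> min_idempotent q = q.
Proof.
move=> /imsetP[q' _ ->]; move/ffunP: min_idempotentK => /(_ q').
by rewrite ffunE.
Qed.

Lemma tn_Loc n q : q \in Loc -> tn n q \in Loc.
Proof.
move=> qL; apply/imsetP; exists (tn n q) => //.
have /transition_monoidP[m me] := min_idempotent_in.
by rewrite -{1}(min_idempotent_Loc qL) me !ffunE tnC.
Qed.

Lemma tn_mulrn_iter n k q : tn (n *+ k) q = iter k (tn n) q.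
Proof. by elim: k => [|k IH]; rewrite ?mulr0n ?tn0 // mulrS tnD IH. Qed.

Lemma tn_order n : exists2 k, (0 < k)%N & {in Loc, forall q, tn (n *+ k) q = q}.
Proof.
pose F (i : 'I_#|End_states|.+1) : End_states := [ffun q => tn (n *+ i) q].
have /injectivePn[i [j ij]] : ~~ injectiveb F.
  apply/negP=> /injectiveP/leq_card; rewrite card_ord; by rewrite ltnn.
wlog ltij : i j ij / (i < j)%N => [H|] Fij.
  have [|ji|/val_inj e] := ltngtP i j; first by move/H; apply.
    by apply: (H j i) => //; rewrite eq_sym.
  by rewrite e eqxx in ij.
pose p := (j - i)%N; have p0 : (0 < p)%N by rewrite subn_gt0.
have per s q : (i <= s)%N -> tn (n *+ (s + p)) q = tn (n *+ s) q.
  move=> /subnK <-; rewrite -addnA /p [(i + _)%N]subnKC ?(ltnW ltij) //.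
  rewrite !mulrnDr !tnD; congr tn.
  by move/ffunP: Fij => /(_ q); rewrite !ffunE.
have per' r s q : (i <= s)%N -> tn (n *+ (s + r * p)) q = tn (n *+ s) q.
  move=> is_; elim: r => [|r IH]; first by rewrite mul0n addn0.
  by rewrite mulSn addnCA addnC per ?IH // (leq_trans is_) // leq_addr.
exists (i.+1 * p)%N; first by rewrite muln_gt0.
set k := (_ * _)%N; have ik : (i <= k)%N by rewrite /k (leq_trans (leqnSn i)) // leq_pmulr.
have kI : [ffun q => tn (n *+ k) q] \in idempotents.
  rewrite inE tn_in_monoid /=; apply/eqP/ffunP=> q; rewrite !ffunE -tnD -mulrnDr.
  exact: per'.
move=> q qL; rewrite -[in LHS](min_idempotent_Loc qL).
move/ffunP: (min_idempotent_absorb kI) => /(_ q); rewrite !ffunE => ->.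
exact: min_idempotent_Loc.
Qed.

Lemma tn_inj_Loc n : {in Loc &, injective (tn n)}.
Proof.
have [[//|k] _ h] := tn_order n; move=> q q' qL q'L e.
by rewrite -(h _ qL) -(h _ q'L) mulrSr !tnD e.
Qed.

Lemma total_kernelP (z : vecZ) : reflect
  {in Loc, forall q, tn (pos_part z) q = tn (neg_part z) q} (z \in total_kernel).
Proof.
rewrite inE /=; apply: (iffP forall_inP) => h q qL; last by apply/eqP/h.
exact/eqP/h.
Qed.

Lemma pos_neg_sub (z z' : vecZ) :
  pos_part (z - z') + (neg_part z + pos_part z') =
  neg_part (z - z') + (pos_part z + neg_part z').
Proof.
have h (x y : int) :
  (absz (Num.max (x - y)%R 0%R) + (absz (Num.max (- x)%R 0%R) + absz (Num.max y 0%R)) =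
   absz (Num.max (- (x - y))%R 0%R) + (absz (Num.max x 0%R) + absz (Num.max (- y)%R 0%R)))%N
   by lia.
by apply/ffunP=> a; rewrite !ffunE; exact: h.
Qed.

Lemma total_kernel_zmod : zmod_closed total_kernel.
Proof.
split=> [|z z' /total_kernelP hz /total_kernelP hz']; apply/total_kernelP => q qL.
  by congr tn; apply/ffunP=> a; rewrite !ffunE oppr0.
apply: (@tn_inj_Loc (neg_part z + pos_part z')); rewrite ?tn_Loc // -!tnD.
rewrite [in LHS]addrC pos_neg_sub [in RHS]addrC.
by rewrite !tnD hz ?tn_Loc // hz'.
Qed.

HB.instance Definition _ :=
  GRing.isZmodClosed.Build vecZ total_kernel total_kernel_zmod.

Definition to_col (z : vecZ) : 'cV[rat]_#|letter| :=
  \col_i (z (enum_val i))%:~R.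

(* Coordinates are indexed through the enumeration of the total alphabet. By
   production_matrix_exists_unique below, exactly one P satisfies this when the
   network is locally irreducible. *)
Definition is_production_matrix (P : 'M[rat]_#|letter|) : Prop :=
  forall (k : vecN) (q : states), to_vecZ k \in total_kernel -> q \in Loc ->
    P *m to_col (to_vecZ k) = to_col (to_vecZ (Mn k q)).

(* (I - P)K; for the production matrix, P k is an integer vector for all k in
   K, so no element is lost by only keeping integer vectors. *)
Definition image_kernel (P : 'M[rat]_#|letter|) : {pred vecZ} :=
  [pred z : vecZ | `[< exists2 k, k \in total_kernel &
                        to_col z = (1%:M - P) *m to_col k >]].

Lemma to_colB z z' : to_col (z - z') = to_col z - to_col z'.
Proof. by apply/colP=> i; rewrite !mxE !ffunE rmorphB. Qed.

Lemma image_kernel_zmod P : zmod_closed (image_kernel P).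
Proof.
have c0 : to_col 0 = 0 by rewrite -[X in to_col X](subrr 0) to_colB subrr.
split=> [|z z']; first by apply/asboolP; exists 0; rewrite ?rpred0 // c0 mulmx0.
move=> /asboolP[k kK e] /asboolP[k' kK' e']; apply/asboolP; exists (k - k').
  exact: rpredB.
by rewrite !to_colB mulmxBr e e'.
Qed.

HB.instance Definition _ P :=
  GRing.isZmodClosed.Build vecZ (image_kernel P) (image_kernel_zmod P).

(* Z^A / (I - P)K *)
Definition quotient_group (P : 'M[rat]_#|letter|) : zmodType :=
  Quotient.quot (image_kernel P).

Lemma Mn_mulrn (k : vecN) r q : tn k q = q -> Mn (k *+ r) q = Mn k q *+ r.
Proof.
move=> kq; elim: r => [|r IH]; last by rewrite !mulrS MnD kq IH.
rewrite !mulr0n; have -> : (0 : vecN) = parikh [::].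
  by apply/ffunP=> a; rewrite !ffunE.
by rewrite Mn_parikh /=; apply/ffunP=> a; rewrite !ffunE.
Qed.

Lemma kernelN (k : vecN) : reflect {in Loc, forall q, tn k q = q}
  (to_vecZ k \in total_kernel).
Proof.
have kp : pos_part (to_vecZ k) = k.
  by apply/ffunP=> a; rewrite !ffunE max_l.
have kn : neg_part (to_vecZ k) = 0.
  by apply/ffunP=> a; rewrite !ffunE max_r // oppr_le0.
by apply: (iffP (total_kernelP _)) => h q qL; move: (h q qL); rewrite kp kn tn0.
Qed.

Definition colN (n : vecN) : 'cV[rat]_#|letter| := to_col (to_vecZ n).

Lemma colND m n : colN (m + n) = colN m + colN n.
Proof. by apply/colP=> i; rewrite !mxE !ffunE PoszD rmorphD. Qed.

Lemma colN0 : colN 0 = 0.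
Proof. by apply/colP=> i; rewrite !mxE !ffunE. Qed.

Lemma colNMn n r : colN (n *+ r) = colN n *+ r.
Proof. by elim: r => [|r IH]; rewrite ?mulr0n ?colN0 // !mulrS colND IH. Qed.

Definition delta (a : letter) : vecN := parikh [:: a].

Lemma colN_delta a : colN (delta a) = delta_mx (enum_rank a) 0.
Proof.
apply/colP=> i; rewrite !mxE !ffunE /= addn0 andbT.
by rewrite -{1}(enum_rankK a) (inj_eq enum_val_inj) eq_sym; case: eqP.
Qed.

Lemma vecN_sum (k : vecN) : k = \sum_a delta a *+ k a.
Proof.
have sumE (I : eqType) (s : seq I) (F : I -> vecN) b :
    (\sum_(i <- s) F i) b = (\sum_(i <- s) F i b)%N.
  elim: s => [|i s IH]; first by rewrite !big_nil ffunE.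
  by rewrite !big_cons ffunE IH.
apply/ffunP=> b; rewrite sumE (bigD1 b) //= big1 => [|a ab].
  by rewrite addn0 ffunMnE ffunE /= eqxx natn.
by rewrite ffunMnE ffunE /= (negbTE ab) mul0rn.
Qed.

Lemma common_order :
  exists2 R, (0 < R)%N & forall a, {in Loc, forall q, tn (delta a *+ R) q = q}.
Proof.
have /fin_all_exists[r hr] (a : letter) : exists r : nat,
    (0 < r)%N /\ {in Loc, forall q, tn (delta a *+ r) q = q}.
  by have [r ? ?] := tn_order (delta a); exists r.
exists (\prod_a r a)%N; first by rewrite prodn_gt0 // => a; have [] := hr a.
move=> a q qL; rewrite (bigD1 a) //= mulrnA tn_mulrn_iter.
by elim: (\prod_(_ | _) _)%N => //= m ->; have [_ ->] := hr a.
Qed.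

Lemma Loc_ex : exists q, q \in Loc.
Proof.
have q0 : states.
  by apply: finfun => v; apply: (enum_val (Ordinal (state_gt0 N v))).
by exists (min_idempotent q0); apply/imsetP; exists q0.
Qed.

Lemma Mn_kernel_indep (k : vecN) q q' : locally_irreducible ->
  to_vecZ k \in total_kernel -> q \in Loc -> q' \in Loc -> Mn k q = Mn k q'.
Proof.
move=> irr /kernelN kK.
have H w p : p \in Loc -> Mn k (tw w p) = Mn k p.
  move=> pL; have := MnD (parikh w) k p; rewrite addrC MnD kK // tn_parikh.
  rewrite [Mn k p + _]addrC => e; apply/ffunP=> a; move/ffunP: e => /(_ a).
  by rewrite !ffunE => /addnI.
move=> qL q'L; have [w [w' e]] := irr q q'.
by rewrite -(H w) // e H.
Qed.

Lemma production_matrix_exists_unique : locally_irreducible ->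
  exists! P, is_production_matrix P.
Proof.
move=> irr; have [R R0 hR] := common_order; have [q0 q0L] := Loc_ex.
have Rn0 : R%:R != 0 :> rat by rewrite pnatr_eq0 -lt0n.
have dK a : to_vecZ (delta a *+ R) \in total_kernel by apply/kernelN/hR.
pose P : 'M[rat]_#|letter| :=
  \matrix_(i, j) (R%:R^-1 * colN (Mn (delta (enum_val j) *+ R) q0) i 0).
have Pd a : P *m colN (delta a) = R%:R^-1 *: colN (Mn (delta a *+ R) q0).
  by apply/colP=> i; rewrite colN_delta -colE !mxE enum_rankK.
exists P; split=> [k q kK qL|P' hP'].
  have qk := elimT (kernelN _) kK.
  apply: (scalerI Rn0); rewrite scalemxAr.
  rewrite !scaler_nat -/(colN k) -/(colN (Mn k q)) -!colNMn -Mn_mulrn ?qk //.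
  have -> : k *+ R = \sum_a delta a *+ R *+ k a.
    by rewrite {1}(vecN_sum k) -sumrMnl; apply: eq_bigr => a _; rewrite mulrnAC.
  have [] : P *m colN (\sum_a delta a *+ R *+ k a) =
      colN (Mn (\sum_a delta a *+ R *+ k a) q) /\
      tn (\sum_a delta a *+ R *+ k a) q = q; last by [].
  elim/big_rec: _ => [|a n _ [IH1 IH2]].
    rewrite tn0 colN0 mulmx0; split=> //.
    by have := @Mn_mulrn 0 0 q (tn0 q); rewrite !mulr0n => ->; rewrite colN0.
  have qa : tn (delta a *+ R *+ k a) q = q.
    by rewrite tn_mulrn_iter; elim: (k a) => //= m ->; rewrite hR.
  rewrite tnD IH2 qa colND mulmxDr IH1 MnD qa colND; split=> //; congr (_ + _).
  rewrite Mn_mulrn ?hR // !colNMn -!scaler_nat -!scalemxAr Pd.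
  by rewrite [R%:R *: _]scalerA mulfV // scale1r (Mn_kernel_indep irr _ q0L qL).
apply/matrixP=> i j; have := hP' _ _ (dK (enum_val j)) q0L.
rewrite -/(colN _) -/(colN (Mn _ _)) colNMn -scaler_nat -scalemxAr => e.
have {}e : P' *m colN (delta (enum_val j)) = P *m colN (delta (enum_val j)).
  by rewrite Pd -e scalerA mulVf // scale1r.
move: e; rewrite colN_delta enum_valK -!colE => /colP/(_ i).
by rewrite [in X in X -> _]mxE [in X in _ = X -> _]mxE => ->.
Qed.

End Dynamics.

Section Grothendieck.
Context (M : nmodType).

Definition groth_rel (x y : M * M) : bool :=
  `[< exists m : M, m + x.1 + y.2 = m + x.2 + y.1 >].

Lemma groth_rel_equiv : equiv_class_of groth_rel.
Proof.
split=> [x|x y|y x z].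
- by apply/asboolP; exists 0; rewrite !add0r addrC.
- by apply: asbool_equiv_eq; split=> -[m e]; exists m; rewrite addrAC -e addrAC.
- move=> /asboolP[m e] /asboolP[m' e']; apply/asboolP; exists (m + m' + y.1).
  rewrite [LHS](AC 5 ((2*3*5)*(1*4)))/= e' [LHS](AC (3*2) ((4*5*2)*(1*3)))/= e.
  by rewrite [LHS](AC (3*2) (1*4*3*2*5)).
Qed.

Canonical groth_rel_equiv_rel := EquivRelPack groth_rel_equiv.
Canonical groth_rel_encModRel := defaultEncModRel groth_rel.

Definition grothendieck := {eq_quot groth_rel}.
HB.instance Definition _ := EqQuotient.on grothendieck.
HB.instance Definition _ := Choice.on grothendieck.

Definition groth_class (x : M * M) : grothendieck := \pi_grothendieck x.

Lemma groth_classP x y :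
  groth_class x = groth_class y <-> exists m, m + x.1 + y.2 = m + x.2 + y.1.
Proof. by split=> [/eqmodP/asboolP|?] //; apply/eqmodP/asboolP. Qed.

Lemma groth_classK x : groth_class (repr x) = x.
Proof. exact: reprK. Qed.

Definition groth_add (x y : grothendieck) : grothendieck :=
  groth_class ((repr x).1 + (repr y).1, (repr x).2 + (repr y).2).

Definition groth_opp (x : grothendieck) : grothendieck :=
  groth_class ((repr x).2, (repr x).1).

Lemma groth_addE x y : groth_add (groth_class x) (groth_class y) =
  groth_class (x.1 + y.1, x.2 + y.2).
Proof.
have /groth_classP[m] := groth_classK (groth_class x).
have /groth_classP[m'] := groth_classK (groth_class y).
set x' := repr _; set y' := repr _; rewrite /groth_add -/x' -/y' => e' e.
apply/groth_classP; exists (m + m') => /=.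
rewrite (AC (2*2*2) ((1*3*5)*(2*4*6)))/= [X in X + _]e [X in _ + X]e'.
by rewrite (AC (3*3) ((1*4)*(2*5)*(3*6))).
Qed.

Lemma groth_oppE x : groth_opp (groth_class x) = groth_class (x.2, x.1).
Proof.
have /groth_classP[m e] := groth_classK (groth_class x).
by apply/groth_classP; exists m => /=; rewrite e.
Qed.

Lemma groth_addA : associative groth_add.
Proof.
move=> x y z; rewrite -[x]groth_classK -[y]groth_classK -[z]groth_classK.
by rewrite !groth_addE !addrA.
Qed.

Lemma groth_addC : commutative groth_add.
Proof.
by move=> x y; rewrite /groth_add addrC [(repr x).2 + _]addrC.
Qed.

Lemma groth_add0 : left_id (groth_class (0, 0)) groth_add.
Proof.
move=> x; rewrite -[x]groth_classK groth_addE !add0r.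
by congr groth_class; case: (repr x).
Qed.

Lemma groth_addN : left_inverse (groth_class (0, 0)) groth_opp groth_add.
Proof.
move=> x; rewrite -[x]groth_classK groth_oppE groth_addE.
by apply/groth_classP; exists 0; rewrite !add0r !addr0 addrC.
Qed.

HB.instance Definition _ := GRing.isZmodule.Build grothendieck
  groth_addA groth_addC groth_add0 groth_addN.

End Grothendieck.

Section Torsion.
Context (G : zmodType).

Definition is_torsion : {pred G} :=
  [pred g : G | `[< exists2 n, (0 < n)%N & g *+ n = 0 >]].

Lemma is_torsion_zmod : zmod_closed is_torsion.
Proof.
split=> [|g h]; first by apply/asboolP; exists 1%N.
move=> /asboolP[m m0 e] /asboolP[n n0 e']; apply/asboolP.
exists (m * n)%N; first by rewrite muln_gt0 m0.
by rewrite mulrnBl mulrnA e mul0rn mulnC mulrnA e' mul0rn subr0.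
Qed.

HB.instance Definition _ := GRing.isZmodClosed.Build G is_torsion is_torsion_zmod.

Definition torsion_subgroup := {g : G | g \in is_torsion}.
HB.instance Definition _ := SubChoice.on torsion_subgroup.
HB.instance Definition _ := [SubChoice_isSubZmodule of torsion_subgroup by <:].

End Torsion.

Lemma torsion_map_proof (G H : zmodType) (f : {additive G -> H})
  (g : torsion_subgroup G) : f (val g) \in @is_torsion H.
Proof.
case: g => g /= /asboolP[n n0 e]; apply/asboolP; exists n => //.
by rewrite -raddfMn e raddf0.
Qed.

Definition torsion_map (G H : zmodType) (f : {additive G -> H})
    (g : torsion_subgroup G) : torsion_subgroup H :=
  exist _ (f (val g)) (torsion_map_proof f g).

Definition is_action (G : zmodType) (X : Type) (act : G -> X -> X) : Prop :=
  (forall x, act 0 x = x) /\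
  (forall g h x, act (g + h) x = act g (act h x)).

Definition is_free_action (G : zmodType) (X : Type) (act : G -> X -> X) : Prop :=
  forall g h x, act g x = act h x -> g = h.

Section TorsionAction.
Context (V : finType) (E : V -> V -> finType) (N : finite_abelian_network E).

Definition shift_groth : zmodType := grothendieck (shift_monoid N).

Definition Tor : zmodType := torsion_subgroup shift_groth.

(* C' is a possible value for the action of g on C. *)
Definition translates (g : Tor) (C C' : rec_component N) : Prop :=
  forall n n' : vecN N,
    val g = groth_class (shift_monoid_of n, shift_monoid_of n') ->
    phi n C = phi n' C'.

Definition invertible (C : rec_component N) : Prop :=
  forall g : Tor, exists C', translates g C C'.

Definition invertible_component := {C : rec_component N | `[< invertible C >]}.

End TorsionAction.

(* Main.v *)
(** Call a letter unbounded at a configuration if legal words from there can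
    fire it arbitrarily often; this only depends on the component. If the removal
    of the firings of a word v from a legal word u >= v is started after v, the
    result is still legal, so v leads from c to a configuration that legally leads
    to the same end as u. Hence two configurations x1.q1 and x2.q2 in recurrent
    components that become equal after firing some words, legal or not, lie in
    the same component, provided that one can go far enough back in their
    histories on the letters that are not unbounded, and that both components
    have the same unbounded letters. The latter follows from Dickson's lemma,
    which extracts periodic segments from walks: histories give vectors k with
    P k <= k, unbounded letters give vectors k with P k >= k, and these are
    compared by a maximum principle. So N^A acts on recurrent components by
    injections.

    If phi(n) and phi(n') agree on one component then n - n' is in (I - P)K by
    the definition of P. Conversely each recurrent component has a nonnegative
    locally recurrent representative, so for n - n' = (I - P)k adding k^+ + k^-
    chips makes both k^+ and k^- legal and phi(s + n) = phi(s + n') for one s.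
    This gives the isomorphism as soon as a recurrent component exists; a
    bi-infinite periodic walk is built from vectors kF <= P kF and kG >= P kG on
    its support, with kF + kG > 0. The action of the torsion group is defined and
    free because the phi(n) are injective. *)

Require Import Defs.
From HB Require Import structures.
From mathcomp Require Import all_boot all_order all_algebra.
From mathcomp Require Import boolp.
From mathcomp Require Import zify ring lra.

Import Order.TTheory GRing.Theory Num.Theory.
Local Open Scope ring_scope.
Local Open Scope quotient_scope.

Set Implicit Arguments.
Unset Strict Implicit.
Unset Printing Implicit Defensive.

(** * Dickson's lemma *)

(** Some index [h n >= n] minimizes [f] over all indices from [n] on; iterating [h] past the
    previous choice gives the subsequence. *)
Lemma monotone_subseq (f : nat -> nat) : exists g : nat -> nat,
  {homo g : i j / (i < j)%N} /\ {homo f \o g : i j / (i <= j)%N}.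
Proof.
have /choice[h hP] n : exists m,
    (n <= m)%N /\ forall m', (n <= m')%N -> (f m <= f m')%N.
  have ex0 : exists v, `[< exists2 m, (n <= m)%N & f m = v >].
    by exists (f n); apply/asboolP; exists n.
  case: (ex_minnP ex0) => v /asboolP[m nm <-] vmin; exists m; split=> // m' nm'.
  by apply: vmin; apply/asboolP; exists m'.
pose g := fix g k := if k is k'.+1 then h (g k').+1 else h 0.
have g_lt k : (g k < g k.+1)%N by have [] := hP (g k).+1.
have g_homo : {homo g : i j / (i < j)%N} by apply: homo_ltn => //; exact: ltn_trans.
exists g; split=> //; apply: homo_leq => // [? ? ? |k /=]; first exact: leq_trans.
have g_min m : (g k <= m)%N -> (f (g k) <= f m)%N.
  case: k => [|k] /= le_m; apply: (hP _).2; apply: leq_trans le_m; exact: (hP _).1.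
exact/g_min/ltnW.
Qed.

(** The sequence is thinned once per coordinate; later thinnings keep the earlier coordinates
    monotone. *)
Lemma dickson (A : finType) (f : nat -> A -> nat) :
  exists i j, (i < j)%N /\ forall a, (f i a <= f j a)%N.
Proof.
suff [g [g_homo g_le]] : exists g : nat -> nat, {homo g : i j / (i < j)%N} /\
    {in enum A, forall a, {homo (fun i => f (g i) a) : i j / (i <= j)%N}}.
  exists (g 0), (g 1); split=> [|a]; first by apply: g_homo.
  by apply: (g_le a) => //; rewrite mem_enum.
elim: (enum A) => [|a s [g [g_homo g_le]]]; first by exists id; split.
have [h [h_homo h_le]] := monotone_subseq (fun i => f (g i) a).
exists (g \o h); split=> [i j ij|b]; first by apply/g_homo/h_homo.
rewrite inE => /orP[/eqP->|bs] i j ij /=; first exact: h_le.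
apply: (g_le b bs); move: ij; rewrite leq_eqVlt => /orP[/eqP->//|ij].
exact/ltnW/h_homo.
Qed.

Lemma homo_exists_bound (A : finType) (B : {pred A}) (f : nat -> A -> nat)
    (n : A -> nat) :
  (forall a, {homo f^~ a : i j / (i <= j)%N}) ->
  {in B, forall a, exists k, (n a <= f k a)%N} ->
  exists k, {in B, forall a, (n a <= f k a)%N}.
Proof.
move=> f_homo h.
have /fin_all_exists[k kP] a : exists k, a \in B -> (n a <= f k a)%N.
  by have [/h[k ?]|] := boolP (a \in B); [exists k|exists 0].
exists (\max_a k a) => a /kP /leq_trans; apply; apply: f_homo.
exact: leq_bigmax.
Qed.


(** * Firing words: exchange and legality *)

Section Words.
Context (V : finType) (E : V -> V -> finType) (N : finite_abelian_network E).

Implicit Types (w u v : word N) (c d : config N) (a b : letter N) (q : states N).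

Definition chips c b : int := c.1 b.
Definition internal c : states N := c.2.
Definition cnt b w : nat := count_mem b w.
Definition sent w q b : nat := Mw w q b.

Lemma cnt_cons b a w : cnt b (a :: w) = ((a == b) + cnt b w)%N.
Proof. by []. Qed.

Lemma cnt_cat b w w' : cnt b (w ++ w') = (cnt b w + cnt b w')%N.
Proof. exact: count_cat. Qed.

Lemma cnt_notin b w : b \notin w -> cnt b w = 0%N.
Proof. exact: count_memPn. Qed.

Lemma cnt_gt0 b w : (0 < cnt b w)%N = (b \in w).
Proof. by rewrite -has_pred1 has_count. Qed.

Lemma cnt_word_of b (n : vecN N) : cnt b (word_of n) = n b.
Proof. by have /ffunP/(_ b) := word_ofK n; rewrite ffunE. Qed.

Lemma cnt_perm w w' : (forall a, cnt a w = cnt a w') -> perm_eq w w'.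
Proof. by move=> e; apply: parikh_perm; apply/ffunP=> a; rewrite !ffunE; apply: e. Qed.

Lemma sent_cons a w q b :
  sent (a :: w) q b = (sent [:: a] q b + sent w (t1 a q) b)%N.
Proof. by rewrite /sent /= addr0 ffunE. Qed.

Lemma sent_cat w w' q b : sent (w ++ w') q b = (sent w q b + sent w' (tw w q) b)%N.
Proof. by rewrite /sent Mw_cat ffunE. Qed.

Lemma fireE a c b :
  chips (fire a c) b = chips c b + (sent [:: a] (internal c) b)%:Z - (a == b : nat)%:Z.
Proof. by rewrite /chips /sent /= addr0 !ffunE /= addn0. Qed.

Lemma internal_fire a c : internal (fire a c) = t1 a (internal c).
Proof. by []. Qed.

Lemma internal_exec w c : internal (exec w c) = tw w (internal c).
Proof. by elim: w c => //= a w IH c; rewrite IH. Qed.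

Lemma chips_exec w c b :
  chips (exec w c) b = chips c b + (sent w (internal c) b)%:Z - (cnt b w)%:Z.
Proof.
elim: w c => [|a w IH] c; first by rewrite /sent ffunE addr0 subr0.
rewrite -[exec _ _]/(exec w (fire a c)) IH fireE (sent_cons a w) cnt_cons internal_fire.
lia.
Qed.

Lemma config_eq c d : (forall b, chips c b = chips d b) -> internal c = internal d -> c = d.
Proof. case: c d => [x q] [y p] e qp; congr pair; [exact/ffunP/e|exact: qp]. Qed.

Lemma exec_perm w w' c : perm_eq w w' -> exec w c = exec w' c.
Proof.
move=> e; have [et eM] := tMw_perm (internal c) e.
apply: config_eq => [b|]; last by rewrite !internal_exec.
by rewrite !chips_exec /sent /cnt eM (permP e).
Qed.

Lemma exec_fire w a c : exec w (fire a c) = fire a (exec w c).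
Proof. by elim: w c => //= b w IH c; rewrite fireC IH. Qed.

Lemma legal_cons a w c : legal (a :: w) c = (1 <= chips c a) && legal w (fire a c).
Proof. by []. Qed.

(** A letter of [u] that occurs in [v] is cancelled against an occurrence there, since [exec]
    depends only on counts. A letter absent from [v] has lost no chips through [v], so it can still
    be fired. *)
Lemma removal u v c : legal u c -> exists2 u', legal u' (exec v c) &
  forall a, cnt a u' = (cnt a u - cnt a v)%N.
Proof.
elim: u v c => [|a u IH] v c; first by exists [::].
rewrite legal_cons => /andP[ca lu]; have [av|av] := boolP (a \in v).
  have vE : perm_eq v (a :: rem a v) by exact: perm_to_rem.
  have [u' lu' u'E] := IH (rem a v) _ lu; exists u'.
    by rewrite (exec_perm _ vE).
  by move=> b; rewrite u'E [in RHS]/cnt (permP vE) /= subnDl.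
have [u' lu' u'E] := IH v _ lu; exists (a :: u') => [|b].
  rewrite legal_cons -exec_fire lu' andbT chips_exec (cnt_notin av); lia.
rewrite !cnt_cons u'E; have [<-|//] := eqVneq a b.
by rewrite (cnt_notin av) !subn0.
Qed.

Lemma leads_removal u v c : legal u c ->
  (forall a, (cnt a v <= cnt a u)%N) -> leads (exec v c) (exec u c).
Proof.
move=> lu vu; have [u' lu' u'E] := removal v lu; exists u'; split=> //.
rewrite -exec_cat; apply/exec_perm/cnt_perm => a.
by rewrite cnt_cat u'E subnKC.
Qed.

Lemma legal_join u v c : legal u c -> legal v c -> exists2 w, legal w c &
  forall a, cnt a w = maxn (cnt a u) (cnt a v).
Proof.
move=> lu lv; have [v' lv' v'E] := removal u lv; exists (u ++ v').
  by rewrite legal_cat lu.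
by move=> a; rewrite cnt_cat v'E maxnE.
Qed.

Lemma legal_le w c d : legal w c -> internal c = internal d ->
  (forall a, a \in w -> chips c a <= chips d a) -> legal w d.
Proof.
elim: w c d => // a w IH c d; rewrite !legal_cons => /andP[ca lw] cd le_cd.
rewrite (le_trans ca) ?le_cd ?mem_head //=; apply: (IH _ _ lw) => [|b bw].
  by rewrite !internal_fire cd.
by rewrite !fireE cd !lerD2r le_cd // inE bw orbT.
Qed.

Lemma legal_of_le w c : {in w, forall a, (cnt a w)%:Z <= chips c a} -> legal w c.
Proof.
elim: w c => // a w IH c le_w; rewrite legal_cons; apply/andP; split.
  by have := le_w a (mem_head _ _); rewrite cnt_cons eqxx; lia.
apply: IH => b bw; have := le_w b; rewrite inE bw orbT => /(_ isT).
by rewrite cnt_cons fireE; lia.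
Qed.

Lemma legal_nseq a n c : n%:Z <= chips c a -> legal (nseq n a) c.
Proof.
elim: n c => // n IH c le_n; rewrite legal_cons; apply/andP; split; first by lia.
by apply: IH; rewrite fireE eqxx; lia.
Qed.

Lemma chips_nonfired w c b : b \notin w -> chips c b <= chips (exec w c) b.
Proof. by move=> bw; rewrite chips_exec (cnt_notin bw); lia. Qed.

Lemma chips_fired w c b : legal w c -> b \in w -> 0 <= chips (exec w c) b.
Proof.
elim: w c => // a w IH c; rewrite legal_cons inE => /andP[ca lw].
have [bw _|bw] := boolP (b \in w); first exact: IH.
rewrite orbF => /eqP ab; subst a; apply: le_trans (chips_nonfired _ bw).
by rewrite fireE eqxx; lia.
Qed.

(** This bound is uniform over legal words, as [dickson_config] requires. *)
Lemma chips_exec_ge w c b : legal w c -> Num.min (chips c b) 0 <= chips (exec w c) b.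
Proof.
have [bw /chips_fired/(_ bw)|bw _] := boolP (b \in w); first by lia.
by have := chips_nonfired c bw; lia.
Qed.

Lemma leads_component c d : leads c d -> component_of c = component_of d.
Proof. by move=> cd; apply/component_ofP; exists d; split=> //; exact: leads_refl. Qed.

Lemma sent_le w w' q b : (forall a, (cnt a w <= cnt a w')%N) ->
  (sent w q b <= sent w' q b)%N.
Proof.
move=> ww'; pose u : vecN N := [ffun a => (cnt a w' - cnt a w)%N].
have /(tMw_perm q)[_ e] : perm_eq w' (w ++ word_of u).
  by apply: cnt_perm => a; rewrite cnt_cat cnt_word_of ffunE subnKC.
by rewrite [in leqRHS]/sent e -/(sent _ _ _) sent_cat leq_addr.
Qed.

End Words.

(** * Periods and production *)

Section Production.
Context (V : finType) (E : V -> V -> finType) (N : finite_abelian_network E).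

Implicit Types (w u v : word N) (c d : config N) (a b : letter N) (q : states N).

Lemma tw_comm w w' q : tw w (tw w' q) = tw w' (tw w q).
Proof. by rewrite -!tw_cat; apply: (tMw_perm q _).1; rewrite perm_catC. Qed.

Lemma tw_perm w w' q : (forall a, cnt a w = cnt a w') -> tw w q = tw w' q.
Proof. by move=> /cnt_perm/(tMw_perm q)[]. Qed.

Lemma sent_perm w w' q b : (forall a, cnt a w = cnt a w') -> sent w q b = sent w' q b.
Proof. by rewrite /sent => /cnt_perm/(tMw_perm q)[_ ->]. Qed.

Lemma sent_comm w w' q b :
  (sent w q b + sent w' (tw w q) b = sent w' q b + sent w (tw w' q) b)%N.
Proof. by rewrite -!sent_cat; apply: sent_perm => a; rewrite !cnt_cat addnC. Qed.

Lemma tw_Loc w q : q \in Loc N -> tw w q \in Loc N.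
Proof. by rewrite -tn_parikh; exact: tn_Loc. Qed.

Lemma tw_inj_Loc w : {in Loc N &, injective (tw w)}.
Proof. by rewrite -tn_parikh; exact: tn_inj_Loc. Qed.

Lemma cnt_nseq_flatten n w a : cnt a (flatten (nseq n w)) = (n * cnt a w)%N.
Proof. by elim: n => //= n IH; rewrite cnt_cat IH mulSn. Qed.

Lemma tw_flatten n w q : tw (flatten (nseq n w)) q = iter n (tw w) q.
Proof. by elim: n => //= n IH; rewrite tw_cat tw_comm IH. Qed.

Lemma tw_flatten_id n w q : tw w q = q -> tw (flatten (nseq n w)) q = q.
Proof. by move=> wq; rewrite tw_flatten; elim: n => //= n ->. Qed.

Lemma sent_flatten n w q b : tw w q = q ->
  sent (flatten (nseq n w)) q b = (n * sent w q b)%N.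
Proof.
move=> wq; elim: n => [|n IH]; first by rewrite /sent ffunE.
by rewrite [flatten _]/= sent_cat wq IH mulSn.
Qed.

Lemma tw_collision v q : exists i j, (i < j)%N /\
  tw (flatten (nseq i v)) q = tw (flatten (nseq j v)) q.
Proof.
pose f (i : 'I_#|states N|.+1) := tw (flatten (nseq i v)) q.
have /injectivePn[i [j ij fij]] : ~~ injectiveb f.
  by apply/negP=> /injectiveP/leq_card; rewrite card_ord ltnn.
have [ltij|ltji|/val_inj e] := ltngtP i j; [by exists i, j|by exists j, i|].
by rewrite e eqxx in ij.
Qed.

(** Two powers of [v] agree at [q]; the complement [w] of [v] in [u] undoes [v] on states fixed by
    [u], so the smaller power cancels. *)
Lemma tw_subword_period u v q : tw u q = q -> (forall a, (cnt a v <= cnt a u)%N) ->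
  exists2 r, (0 < r)%N & tw (flatten (nseq r v)) q = q.
Proof.
move=> uq vu; have [i [j [ij e]]] := tw_collision v q.
pose w := word_of [ffun a => (cnt a u - cnt a v)%N : nat] : word N.
have uE s p : tw (flatten (nseq s w)) (tw (flatten (nseq s v)) p) = tw (flatten (nseq s u)) p.
  rewrite -tw_cat; apply: tw_perm => a.
  by rewrite cnt_cat !cnt_nseq_flatten cnt_word_of ffunE -mulnDr subnKC.
have jE := subnK (ltnW ij); set r := (j - i)%N in jE.
exists r; first by rewrite subn_gt0.
have := congr1 (tw (flatten (nseq i w))) e.
rewrite -jE nseqD flatten_cat tw_cat !uE [in RHS]tw_comm !(tw_flatten_id _ uq).
by move=> <-.
Qed.

Context (P : 'M[rat]_#|letter N|).
Context (irrN : locally_irreducible N) (prodP : is_production_matrix P).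

Definition coef b a : rat := P (enum_rank b) (enum_rank a).
Definition produced (k : letter N -> rat) b : rat := \sum_a coef b a * k a.

Lemma mulmx_to_col (z : vecZ N) b :
  (P *m to_col z) (enum_rank b) 0 = produced (fun a => (z a)%:~R) b.
Proof.
rewrite mxE (reindex enum_rank) /=; last exact/onW_bij/enum_rank_bij.
by apply: eq_bigr => a _; rewrite !mxE enum_rankK.
Qed.

(** Irreducibility joins [q] and [q'] at a common state, which [u] also fixes because words commute;
    [p'] then cancels by injectivity on [Loc N]. *)
Lemma fixed_by_Loc u q : tw u q = q -> {in Loc N, forall q', tw u q' = q'}.
Proof.
move=> uq q' q'L; have [p [p' e]] := irrN q q'.
by apply: (@tw_inj_Loc p'); rewrite ?tw_Loc // tw_comm -e tw_comm uq.
Qed.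

Lemma cycle_kernel u q : tw u q = q -> to_vecZ (parikh u) \in @total_kernel _ _ N.
Proof. by move=> /fixed_by_Loc h; apply/kernelN => q' q'L; rewrite tn_parikh h. Qed.

(** This extends the defining property of [P] from [Loc N] to any state fixed by [u]: commuting [p]
    past [u] shows that moving the state along [p] leaves the messages of [u] unchanged. *)
Lemma sent_cycle u q b : tw u q = q ->
  (sent u q b)%:R = produced (fun a => (cnt a u)%:R) b.
Proof.
move=> uq; have [q0 q0L] := Loc_ex N; have [p [p' e]] := irrN q q0.
have -> : sent u q b = sent u (tw p q) b.
  by have := sent_comm p u q b; rewrite uq addnC => /addIn.
rewrite e; have q0L' : tw p' q0 \in Loc N by exact: tw_Loc.
have /colP/(_ (enum_rank b)) := prodP (cycle_kernel uq) q0L'.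
rewrite mulmx_to_col !mxE enum_rankK Mn_parikh ffunE => h.
by apply: etrans (esym h) _; apply: eq_bigr => a _; rewrite !ffunE.
Qed.

Lemma produced_sub (k l : letter N -> rat) b :
  produced (fun a => k a - l a) b = produced k b - produced l b.
Proof. by rewrite /produced -sumrB; apply: eq_bigr => a _; rewrite mulrBr. Qed.

(** The word [r], made of copies of [w], inverts [w] on [Loc N]. Appending it to [w] and [w'] turns
    both into cycles, to which [sent_cycle] applies, and the contribution of [r] cancels. *)
Lemma tw_eq_kernel w w' q : tw w q = tw w' q ->
  to_vecZ (parikh w) - to_vecZ (parikh w') \in @total_kernel _ _ N /\
  forall b, (sent w q b)%:R - (sent w' q b)%:R =
    produced (fun a => (cnt a w)%:R - (cnt a w')%:R) b.
Proof.
move=> e; have [q0 q0L] := Loc_ex N; have [p [p' pe]] := irrN q q0.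
have q'L : tw p q \in Loc N by rewrite pe tw_Loc.
have e' : tw w (tw p q) = tw w' (tw p q) by rewrite tw_comm e tw_comm.
have [[//|k] _ hk] := tn_order (parikh w).
set r := word_of (parikh w *+ k).
have wr : tw (w ++ r) (tw p q) = tw p q.
  rewrite -[RHS](hk _ q'L) mulrSr tnD tn_parikh tw_cat -/(tn _ _) //.
have w'r : tw (w' ++ r) (tw p q) = tw p q by rewrite tw_cat -e' -tw_cat.
split=> [|b].
  have -> : to_vecZ (parikh w) - to_vecZ (parikh w') =
      to_vecZ (parikh (w ++ r)) - to_vecZ (parikh (w' ++ r)).
    by rewrite !parikh_cat !to_vecZD opprD addrACA subrr addr0.
  by apply: rpredB; [exact: cycle_kernel wr|exact: cycle_kernel w'r].
have -> : (sent w q b)%:R - (sent w' q b)%:R =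
    (sent (w ++ r) (tw p q) b)%:R - (sent (w' ++ r) (tw p q) b)%:R :> rat.
  have := sent_comm p w q b; have := sent_comm p w' q b.
  rewrite !sent_cat -e' -e; set x := sent _ (tw w (tw p q)) b.
  move=> /(congr1 (fun n : nat => n%:R : rat)); rewrite !natrD => h'.
  move=> /(congr1 (fun n : nat => n%:R : rat)); rewrite !natrD => h.
  lra.
rewrite !sent_cycle // -produced_sub; congr produced.
by apply/funext => a; rewrite !cnt_cat !natrD; ring.
Qed.

Lemma coef_ge0 b a : 0 <= coef b a.
Proof.
have [q0 q0L] := Loc_ex N; have [r r_gt0 hr] := tn_order (parikh [:: a]).
have := @sent_cycle (word_of (parikh [:: a] *+ r)) q0 b (hr _ q0L).
rewrite /produced (bigD1 a) //= big1 => [|c ca]; last first.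
  by rewrite cnt_word_of ffunMnE ffunE /= eq_sym (negbTE ca) mul0rn mulr0.
rewrite cnt_word_of ffunMnE ffunE /= eqxx addr0 => e.
have : 0 <= coef b a * ((1 + 0)%N *+ r)%:R by rewrite -e ler0n.
by rewrite pmulr_lge0 // ltr0n natn.
Qed.

(** Firing [a] alone is eventually periodic on states, and a positive coefficient makes each period
    send at least one [b]. *)
Lemma sent_unbounded b a q n : 0 < coef b a ->
  exists m, (n <= sent (nseq m a) q b)%N.
Proof.
move=> ba; have [i [j [ij]]] := tw_collision [:: a] q.
have nseqE m : flatten (nseq m [:: a]) = nseq m a by elim: m => //= m ->.
rewrite !nseqE -{1}(subnK (ltnW ij)) nseqD.
set q' := tw _ q; set r := (j - i)%N => e.
have rq' : tw (nseq r a) q' = q' by rewrite tw_comm -tw_cat.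
have cntr (l : letter N) : cnt l (nseq r a) = (if l == a then r else 0)%N.
  by rewrite /cnt count_nseq /= eq_sym; case: eqP; rewrite ?mul1n.
have r_gt0 : (0 < sent (nseq r a) q' b)%N.
  rewrite -(ltr0n rat) sent_cycle // /produced (bigD1 a) //= big1 => [|c ca].
    by rewrite cntr eqxx addr0 mulr_gt0 // ltr0n subn_gt0.
  by rewrite cntr (negbTE ca) mulr0.
exists (i + n * r)%N; rewrite nseqD sent_cat -/q'.
have -> : nseq (n * r) a = flatten (nseq n (nseq r a)).
  by elim: n => // n IH; rewrite mulSn nseqD IH.
by rewrite sent_flatten // (leq_trans _ (leq_addl _ _)) // leq_pmulr.
Qed.

End Production.

(** * Unbounded letters and histories *)

Section Unbounded.
Context (V : finType) (E : V -> V -> finType) (N : finite_abelian_network E).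

Implicit Types (w u v : word N) (c d : config N) (a b : letter N) (q : states N).

Definition unbounded c b : Prop :=
  forall n, exists2 w, legal w c & (n <= cnt b w)%N.

Lemma unbounded_leads c d b : leads c d -> unbounded c b <-> unbounded d b.
Proof.
move=> [u [lu ud]]; split=> h n.
  have [w lw wn] := h (n + cnt b u)%N; have [w' lw' w'E] := removal u lw.
  by exists w'; [rewrite -ud|rewrite w'E; lia].
have [w lw wn] := h n; exists (u ++ w); first by rewrite legal_cat lu ud.
by rewrite cnt_cat (leq_trans wn) // leq_addl.
Qed.

Lemma unbounded_join c (B : {pred letter N}) (n : letter N -> nat) :
  {in B, forall b, unbounded c b} ->
  exists2 w, legal w c & {in B, forall b, (n b <= cnt b w)%N}.
Proof.
move=> h; suff [w lw wn] : exists2 w, legal w c &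
    {in enum (letter N), forall b, b \in B -> (n b <= cnt b w)%N}.
  by exists w => // b bB; apply: wn; rewrite ?mem_enum.
elim: (enum _) => [|b s [w lw wn]]; first by exists [::].
have [bB|bB] := boolP (b \in B); last first.
  by exists w => // a; rewrite inE => /orP[/eqP->|/wn//]; rewrite (negbTE bB).
have [u lu un] := h b bB (n b); have [w' lw' w'E] := legal_join lw lu.
exists w' => // a; rewrite inE w'E leq_max => /orP[/eqP->|/wn h' /h'->//].
by rewrite un orbT.
Qed.

(** Indices of a history increase into the past, so the word of largest index is fired first. *)
Fixpoint segment (p : nat -> word N) i k : word N :=
  if k is k'.+1 then p (i + k')%N ++ segment p i k' else [::].

Definition history (h : nat -> config N) (p : nat -> word N) : Prop :=
  forall k, leads_by (p k) (h k.+1) (h k).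

Lemma leads_segment h p i k : history h p ->
  leads_by (segment p i k) (h (i + k)%N) (h i).
Proof.
move=> hp; elim: k => [|k [l e]] /=; first by rewrite addn0.
have [l' e'] := hp (i + k)%N.
by rewrite addnS /leads_by legal_cat exec_cat e' l' l e.
Qed.

Lemma cnt_segment_homo p i b : {homo (fun k => cnt b (segment p i k)) : k l / (k <= l)%N}.
Proof.
apply: homo_leq => // [? ? ? |k /=]; first exact: leq_trans.
by rewrite cnt_cat leq_addl.
Qed.

Lemma cnt_segment_unbounded p b : (forall n, exists2 m, (n <= m)%N & b \in p m) ->
  forall i n, exists k, (n <= cnt b (segment p i k))%N.
Proof.
move=> h i; elim=> [|n [k kn]]; first by exists 0.
have [m im bm] := h (i + k)%N; exists (m - i).+1; rewrite /= cnt_cat.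
rewrite subnKC; last by apply: leq_trans im; rewrite leq_addr.
rewrite -add1n leq_add // ?cnt_gt0 //.
by apply: leq_trans kn (cnt_segment_homo _ _ _ _); lia.
Qed.

Lemma segment_join p (B : {pred letter N}) (n : letter N -> nat) i :
  {in B, forall b, forall n, exists2 m, (n <= m)%N & b \in p m} ->
  exists k, {in B, forall b, (n b <= cnt b (segment p i k))%N}.
Proof.
move=> h; apply: (homo_exists_bound (f := fun k b => cnt b (segment p i k))) => b.
  exact: cnt_segment_homo.
by move=> /h/cnt_segment_unbounded.
Qed.

Lemma cnt_mkseq_unbounded (f : nat -> letter N) b :
  (forall n, exists2 m, (n <= m)%N & f m = b) ->
  forall n, exists k, (n <= cnt b (mkseq f k))%N.
Proof.
move=> h; elim=> [|n [k kn]]; first by exists 0.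
have [m km fm] := h k; exists m.+1; rewrite mkseqS -cats1 cnt_cat cnt_cons fm eqxx.
rewrite -[m](subnKC km) /mkseq iotaD map_cat cnt_cat; move: kn; rewrite /mkseq; lia.
Qed.

(** The walk is cut at index 0. Letters fired infinitely often after the cut are unbounded there; by
    diversity all others are fired infinitely often before it. *)
Lemma recurrent_split (C : component N) : recurrent C ->
  exists h p, [/\ history h p, component_of (h 0) = C &
    forall b, unbounded (h 0) b \/ forall n, exists2 m, (n <= m)%N & b \in p m].
Proof.
move=> [I [c [a [[dI wI] dv comp_c]]]].
(* If the walk has no past, the history stays at [c 0] with empty words. *)
pose p k := if I (- k%:Z) && I (- k.+1%:Z) then [:: a (- k%:Z)] else [::].
pose h k := if I (- k%:Z) then c (- k%:Z) else c 0.
have I0 : I 0 by case: dI {wI dv comp_c p h}.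
have pred_neg k : (- k%:Z) - 1 = - k.+1%:Z by lia.
have neg0 k : I (- k.+1%:Z) -> I (- k%:Z) by case: dI {wI dv comp_c p h I0}; lia.
have pos0 (k : nat) : I k.+1 -> I k by case: dI {wI dv comp_c p h I0 neg0}; lia.
exists h, p; split=> [k||b].
- rewrite /p /h; have [Ik1|nIk1] := boolP (I (- k.+1%:Z)).
    rewrite (neg0 _ Ik1) /=; have := wI (- k%:Z); rewrite pred_neg.
    by apply=> //; exact: neg0.
  rewrite andbF; case: ifP => // Ik; case: k Ik nIk1 => [|k] Ik nIk1.
    by rewrite oppr0.
  by exfalso; move: Ik nIk1 I0; case: dI {wI dv comp_c p h neg0 pos0}; lia.
- by rewrite /h oppr0 I0 comp_c.
have [fwd|/existsNP[n0 nfwd]] := pselect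
    (forall n, exists2 m : nat, (n <= m)%N & I m.+1 /\ a m.+1 = b).
  left=> n.
  have Ipos (k : nat) : I k.
    have [m km [Im _]] := fwd k; have {}Im := pos0 _ Im.
    move: km => /subnKC mE; rewrite -mE in Im.
    by elim: (m - k)%N Im => [|j IH]; rewrite ?addn0 // addnS => /pos0.
  have [k kn] := @cnt_mkseq_unbounded (fun m => a m.+1) b
    (fun n => let: ex_intro2 m nm h := fwd n in ex_intro2 _ _ m nm h.2) n.
  exists (mkseq (fun m => a m.+1) k) => //; rewrite /h oppr0 I0.
  suff [] : leads_by (mkseq (fun m => a m.+1) k) (c 0) (c k) by [].
  elim: k {kn} => // k [l e]; rewrite mkseqS -cats1 /leads_by legal_cat exec_cat l e.
  have -> : c k = c (k.+1%:Z - 1) by congr c; lia.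
  by apply: wI => //; have -> : k.+1%:Z - 1 = k by lia.
(* The bound forces [i <= 0]: a positive [i] would equal [m.+1] with [n0 <= m], against [nfwd]. *)
right=> n; have [i [Ii ni ai]] := dv b (maxn n n0 + 1)%N.
have [i_pos|i_neg] := ltP 0 i.
  exfalso; apply: nfwd; exists `|i|.-1%N; first by lia.
  by have -> : `|i|.-1.+1%:Z = i by lia.
have iE : - `|i|%:Z = i by lia.
exists `|i|%N; first by lia.
rewrite /p iE Ii ai; suff -> : I (- `|i|.+1%:Z) by rewrite /= inE.
by move: Ii ni i_neg; case: dI {wI dv comp_c p h neg0 pos0 I0 nfwd}; lia.
Qed.

(** The state enters through 0/1 indicator coordinates, where domination forces equality;
    subtracting [l] makes the chip counts natural numbers. *)
Lemma dickson_config (e : nat -> config N) (B : {pred letter N}) (l : letter N -> int) :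
  (forall n, {in B, forall b, l b <= chips (e n) b}) ->
  exists i j, [/\ (i < j)%N, internal (e i) = internal (e j) &
    {in B, forall b, chips (e i) b <= chips (e j) b}].
Proof.
move=> le_l; pose f n (x : letter N + states N) : nat :=
  match x with
  | inl b => if b \in B then `|chips (e n) b - l b|%N else 0%N
  | inr q => internal (e n) == q
  end.
have [i [j [ij fij]]] := dickson f; exists i, j; split=> // [|b bB].
  by have := fij (inr (internal (e i))); rewrite /= eqxx lt0b => /eqP.
by have := fij (inl b); have := le_l i b bB; have := le_l j b bB; rewrite /= bB; lia.
Qed.

End Unbounded.

(** * Recurrent components in one orbit *)

Section Recurrent.
Context (V : finType) (E : V -> V -> finType) (N : finite_abelian_network E).
Context (P : 'M[rat]_#|letter N|).
Context (irrN : locally_irreducible N) (prodP : is_production_matrix P).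

Implicit Types (w u v : word N) (c d : config N) (a b : letter N) (q : states N).

(** Firing [a] often sends many chips to [b], and those left unfired by the legal word are fired at
    its end. The term [|chips c b|] covers an initial debt. *)
Lemma unbounded_coef c a b : 0 < coef P b a -> unbounded c a -> unbounded c b.
Proof.
move=> ba ua n.
have [m mP] := sent_unbounded irrN prodP (internal c) (`|chips c b| + n)%N ba.
have [w lw mw] := ua m; have := chips_exec w c b.
have : (sent (nseq m a) (internal c) b <= sent w (internal c) b)%N.
  apply: sent_le => l; rewrite /cnt count_nseq /=.
  by case: eqP => [<-|_]; rewrite ?mul1n ?mul0n.
move=> le_s e; have [nw|wn] := leqP n (cnt b w); first by exists w.
exists (w ++ nseq (n - cnt b w) b).
  by rewrite legal_cat lw; apply: legal_nseq; lia.
by rewrite cnt_cat [cnt b (nseq _ _)]count_nseq /= eqxx; lia.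
Qed.

(** Legal words firing [b0] are chained without end. Dickson's lemma gives two configurations with
    equal states between which no chip count drops; the word joining them is a cycle that produces
    at least what it consumes. *)
Lemma unbounded_production c b0 : unbounded c b0 -> exists2 u, b0 \in u &
  forall b, (cnt b u)%:R <= produced P (fun a => (cnt a u)%:R) b.
Proof.
move=> ub0.
have /choice[s sP] d : exists w, unbounded d b0 -> legal w d /\ b0 \in w.
  have [h|h] := pselect (unbounded d b0); last by exists [::].
  by have [w lw] := h 1; rewrite cnt_gt0 => wb; exists w.
pose e n := iter n (fun d => exec (s d) d) c.
have eP n : unbounded (e n) b0.
  elim: n => // n IH; have [l _] := sP _ IH.
  have en : leads (e n) (e n.+1) by exists (s (e n)).
  exact: (unbounded_leads b0 en).1.
have step n : leads_by (s (e n)) (e n) (e n.+1) by have [] := sP _ (eP n).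
have steps i k : exists2 w, leads_by w (e i) (e (i + k.+1)%N) & b0 \in w.
  elim: k => [|k [w [lw we] wb]].
    by exists (s (e i)); rewrite ?addn1 //; have [] := sP _ (eP i).
  have [l' e'] := step (i + k.+1)%N; exists (w ++ s (e (i + k.+1)%N)).
    by rewrite /leads_by [(i + k.+2)%N]addnS legal_cat exec_cat lw we l'.
  by rewrite mem_cat wb.
have from_c n : exists2 w, legal w c & exec w c = e n.
  case: n => [|n]; first by exists [::].
  by have [w [lw we] _] := steps 0 n; exists w.
have [i [j [ij eq_ij le_ij]]] : exists i j, [/\ (i < j)%N,
    internal (e i) = internal (e j) &
    {in predT, forall b, chips (e i) b <= chips (e j) b}].
  apply: (dickson_config (l := fun b => Num.min (chips c b) 0)) => n b _.
  by have [w lw <-] := from_c n; exact: chips_exec_ge.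
have [u [lu eu] ub] := steps i (j - i).-1; exists u => // b.
rewrite (_ : (i + _.+1)%N = j) in eu; last by lia.
have qu : tw u (internal (e i)) = internal (e i) by rewrite -internal_exec eu.
rewrite -(sent_cycle irrN prodP b qu) ler_nat.
have := le_ij b isT; rewrite -eu chips_exec; lia.
Qed.

(** Letters of [T] are replenished on every pass; each other letter has spare chips to pay for [n]
    passes. *)
Lemma legal_repeat (T : {pred letter N}) u d d' n : legal u d ->
  tw u (internal d) = internal d ->
  (forall b, b \in T -> sent u (internal d) b = cnt b u) ->
  internal d' = internal d ->
  (forall b, chips d b + (if b \in T then 0 else (n * cnt b u)%N)%:Z <= chips d' b) ->
  legal (flatten (nseq n u)) d'.
Proof.
move=> lu uq uT; elim: n d' => //= n IH d' dd' le_d'.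
rewrite legal_cat (legal_le lu) //=; last first.
  by move=> b _; apply: le_trans (le_d' b); lia.
apply: IH; first by rewrite internal_exec dd'.
move=> b; rewrite chips_exec dd'; have := le_d' b; have := uT b.
by case: ifP => bT; [move=> ->; lia|rewrite mulSn; lia].
Qed.

(* Raise the chip counts off T until u can be repeated; removing the firings
   off T from that word leaves a word in T that is legal without the extra
   chips, since T receives nothing from outside. *)
Lemma unbounded_isolated (T : {pred letter N}) u d : legal u d ->
  internal (exec u d) = internal d ->
  {in T, forall b, chips (exec u d) b = chips d b} ->
  {in T, forall b a, a \notin T -> coef P b a = 0} ->
  {in T, forall b, b \in u -> unbounded d b}.
Proof.
move=> lu; rewrite internal_exec => uq chT iso b bT bu n.
pose v := [seq a <- u | a \notin T].
have cnt_v a : cnt a v = (if a \in T then 0 else cnt a u)%N.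
  case: ifP => aT; first by apply: cnt_notin; rewrite mem_filter aT.
  rewrite /cnt count_filter; apply: eq_count => x /=.
  by case: eqP => // ->; rewrite aT.
have [|r r_gt0 rv] := @tw_subword_period _ _ N u v _ uq.
  by move=> a; rewrite cnt_v; case: ifP.
pose d' : config N := ([ffun a => chips d a +
  (if a \in T then 0 else (n * r * cnt a u)%N)%:Z], internal d).
have chips_d' a : chips d' a = chips d a + (if a \in T then 0 else (n * r * cnt a u)%N)%:Z.
  by rewrite /chips /d' /= ffunE.
have lU : legal (flatten (nseq (n * r) u)) d'.
  apply: (legal_repeat (T := T) lu uq) => // [l lT|l]; last by rewrite chips_d'.
  by have := chT _ lT; rewrite chips_exec; lia.
pose W := flatten (nseq n (flatten (nseq r v))).
have Wd : tw W (internal d') = internal d by exact: tw_flatten_id.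
have [u' lu' cnt_u'] := removal W lU.
have cnt_W a : cnt a W = (n * r * cnt a v)%N by rewrite !cnt_nseq_flatten mulnA.
exists u'; last first.
  rewrite cnt_u' cnt_W cnt_v bT muln0 subn0 cnt_nseq_flatten -mulnA leq_pmulr //.
  by rewrite muln_gt0 r_gt0 cnt_gt0.
apply: (legal_le lu') => [|a]; first by rewrite internal_exec.
rewrite -cnt_gt0 cnt_u' cnt_W cnt_nseq_flatten cnt_v.
case: ifP => aT; last by rewrite subnn.
move=> _; rewrite chips_exec chips_d' aT cnt_W cnt_v aT.
(* [W] fires only letters outside [T], from which [T] receives nothing. *)
suff -> : sent W (internal d') a = 0%N by lia.
apply/eqP; rewrite -(eqr_nat rat) (sent_cycle irrN prodP) // /produced big1 // => l _.
rewrite cnt_W cnt_v; case: ifP => lT; first by rewrite muln0 mulr0.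
by rewrite iso ?lT // mul0r.
Qed.

(* On the set G of letters that are not unbounded at h 0, the history gives k1
   with P k1 <= k1; if b0 were in G, then d would give k2 with P k2 >= k2. On the
   set T where k2 / k1 is maximal all these inequalities are equalities, so T
   receives nothing from outside and unbounded_isolated applies. *)
Lemma unbounded_history h p b0 d : history h p ->
  (forall b, unbounded (h 0) b \/ forall n, exists2 m, (n <= m)%N & b \in p m) ->
  unbounded d b0 -> unbounded (h 0) b0.
Proof.
move=> hp split_h ub0; apply: contrapT => nb0.
pose G : {pred letter N} := [pred b | ~~ `[< unbounded (h 0) b >]].
have GP b : reflect (~ unbounded (h 0) b) (b \in G).
  by rewrite inE; apply: (iffP idP) => /asboolPn.
have b0G : b0 \in G by exact/GP.
have G_inf b : b \in G -> forall n, exists2 m, (n <= m)%N & b \in p m.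
  by move=> /GP ?; case: (split_h b).
have coefG b a : b \in G -> a \notin G -> coef P b a = 0.
  move=> /GP bG; rewrite inE negbK => /asboolP ua; apply/eqP/negPn/negP => ba.
  apply: bG; apply: unbounded_coef ua; by rewrite lt_neqAle eq_sym ba (coef_ge0 irrN prodP).
have [k2 b0k2 k2P] := unbounded_production ub0.
have /choice[next nextP] i : exists k, {in G, forall b, (1 <= cnt b (segment p i k))%N}.
  exact: (segment_join (fun=> 1%N) _ G_inf).
(* The times [t n] cut the history into blocks in which every letter of [G] fires, so the chips on
   [G] are nonnegative at each cut. *)
pose t := fix t n := if n is n'.+1 then (t n' + next (t n'))%N else 0%N.
have t_homo : {homo t : i j / (i <= j)%N}.
  by apply: homo_leq => // [? ? ? |n]; [exact: leq_trans|exact: leq_addr].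
have seg_t i j b : (i < j)%N -> b \in G -> b \in segment p (t i) (t j - t i).
  move=> ij bG; rewrite -cnt_gt0; apply: leq_trans (nextP (t i) _ bG) _.
  by apply: cnt_segment_homo; have := t_homo _ _ ij; rewrite /= -/t; lia.
have lead_t i j : (i <= j)%N -> leads_by (segment p (t i) (t j - t i)) (h (t j)) (h (t i)).
  by move=> ij; rewrite -[in h (t j)](subnKC (t_homo _ _ ij)); exact: leads_segment.
have [i [j [ij hij le_ij]]] : exists i j, [/\ (i < j)%N,
    internal (h (t i)) = internal (h (t j)) &
    {in G, forall b, chips (h (t i)) b <= chips (h (t j)) b}].
  apply: (dickson_config (l := fun=> 0)) => n b bG.
  have [l <-] := lead_t _ _ (leqnSn n); apply: chips_fired => //; exact: seg_t.
have [lu ue] := lead_t _ _ (ltnW ij); set u := segment _ _ _ in lu ue.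
have uG b : b \in G -> b \in u by exact: seg_t.
pose k1 a : rat := (cnt a u)%:R; pose k a : rat := (cnt a k2)%:R.
have k1_gt0 b : b \in G -> 0 < k1 b by move=> /uG; rewrite ltr0n cnt_gt0.
have sent_u b : (sent u (internal (h (t j))) b)%:R = produced P k1 b.
  by apply: (sent_cycle irrN prodP); rewrite -internal_exec ue.
have k1P b : b \in G -> produced P k1 b <= k1 b.
  by move=> bG; rewrite -sent_u ler_nat; have := le_ij _ bG; rewrite -ue chips_exec; lia.
have [x xG x_max] := arg_maxP (fun b => k b / k1 b) b0G.
have {}xG : x \in G := xG.
have {}x_max b : b \in G -> k b <= k x / k1 x * k1 b.
  by move=> bG; rewrite -ler_pdivrMr ?k1_gt0 //; exact: x_max.
set rho := k x / k1 x in x_max.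
have rho_gt0 : 0 < rho.
  rewrite -(pmulr_lgt0 _ (k1_gt0 _ b0G)); apply: lt_le_trans (x_max _ b0G).
  by rewrite ltr0n cnt_gt0.
pose T : {pred letter N} := [pred b in G | k b == rho * k1 b].
have TE b : (b \in T) = (b \in G) && (k b == rho * k1 b) by [].
have TG b : b \in T -> b \in G by case/andP.
have xT : x \in T by rewrite TE xG /= /rho divfK // gt_eqF ?k1_gt0.
have diff_ge0 b a : b \in T -> 0 <= coef P b a * (rho * k1 a - k a).
  move=> /TG bG; have [aG|aG] := boolP (a \in G); last by rewrite coefG // mul0r.
  by rewrite mulr_ge0 ?(coef_ge0 irrN prodP) // subr_ge0 x_max.
have diffE b :
    \sum_a coef P b a * (rho * k1 a - k a) = rho * produced P k1 b - produced P k b.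
  rewrite /produced mulr_sumr -sumrB; apply: eq_bigr => a _; ring.
(* For [b] in [T], the chain [rho * P k1 <= rho * k1 = k <= P k] bounds the sum above by 0, while
   its terms are nonnegative. *)
have sum_eq b : b \in T ->
    \sum_a coef P b a * (rho * k1 a - k a) = 0 /\ produced P k1 b = k1 b.
  move=> bT; have /andP[bG /eqP kb] := bT.
  have le1 : rho * produced P k1 b <= rho * k1 b by rewrite ler_pM2l // k1P.
  have le2 : k b <= produced P k b by exact: k2P.
  have : 0 <= \sum_a coef P b a * (rho * k1 a - k a).
    by apply: sumr_ge0 => a _; exact: diff_ge0.
  rewrite diffE => le3.
  split; first by lra.
  by apply: (mulfI (lt0r_neq0 rho_gt0)); lra.
apply: (elimT (GP x) xG); have tj0 : leads (h (t j)) (h 0).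
  exists (segment p 0 (t j)); exact: (leads_segment 0 (t j) hp).
apply: (unbounded_leads x tj0).1.
  apply: (unbounded_isolated (T := T) lu) xT (uG _ xG); first by rewrite ue.
  - move=> b bT; rewrite chips_exec; have [_] := sum_eq _ bT; rewrite -sent_u => /eqP.
    by rewrite eqr_nat => /eqP ->; rewrite addrK.
  - move=> b bT a; rewrite TE negb_and => /orP[|ab]; first exact/coefG/TG.
    have [+ _] := sum_eq _ bT => /eqP; rewrite psumr_eq0; last by move=> *; exact: diff_ge0.
    move=> /allP/(_ a (mem_index_enum _)) /=; rewrite mulf_eq0 subr_eq0 [rho * _ == _]eq_sym (negbTE ab).
    by rewrite orbF => /eqP.
Qed.

Definition quasi_related c d := exists w w', exec w c = exec w' d.

Lemma related_quasi c d : component_of c = component_of d -> quasi_related c d.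
Proof. by move=> /component_ofP[e [[w [_ <-]] [w' [_ e']]]]; exists w, w'. Qed.

Lemma quasi_trans c d e : quasi_related c d -> quasi_related d e -> quasi_related c e.
Proof.
move=> [w [w' cd]] [v [v' de]]; exists (w ++ v), (v' ++ w').
rewrite exec_cat cd -exec_cat.
by rewrite (exec_perm (w := w' ++ v) (w' := v ++ w')) ?exec_cat ?de // perm_catC.
Qed.

Lemma to_Loc : exists m, forall q, tw m q \in Loc N.
Proof.
have /transition_monoidP[n nE] := min_idempotent_in N.
exists (word_of n) => q; apply/imsetP; exists q => //.
by rewrite nE ffunE.
Qed.

Lemma exec_inj_Loc w c d : internal c \in Loc N -> internal d \in Loc N ->
  exec w c = exec w d -> c = d.
Proof.
move=> cL dL e; have qe : internal c = internal d.
  by apply: (tw_inj_Loc (w := w)) => //; rewrite -!internal_exec e.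
apply: config_eq => // b; have : chips (exec w c) b = chips (exec w d) b by rewrite e.
by rewrite !chips_exec qe; lia.
Qed.

(** From far back, [u1 ++ w1] and [u2 ++ w2] lead to the same configuration. Cancelling their common
    part [s] leaves [s1] and [s2]; with [m] added, each is dominated by a legal word, so its end
    stays in [C1] or [C2]. Injectivity of [s] on locally recurrent states identifies the two
    ends. *)
Lemma recurrent_quasi (C1 C2 : component N) c1 c2 : recurrent C1 -> recurrent C2 ->
  component_of c1 = C1 -> component_of c2 = C2 -> quasi_related c1 c2 -> C1 = C2.
Proof.
move=> /recurrent_split[h1 [p1 [hp1 h1C split1]]].
move=> /recurrent_split[h2 [p2 [hp2 h2C split2]]] c1C c2C q12.
have [w1 [w2 e12]] : quasi_related (h1 0) (h2 0).
  apply: quasi_trans (quasi_trans _ q12) _; apply: related_quasi.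
    by rewrite h1C.
  by rewrite h2C.
pose G : {pred letter N} := [pred b | ~~ `[< unbounded (h1 0) b >]].
have G1 b : b \notin G -> unbounded (h1 0) b by rewrite negbK => /asboolP.
have G2 b : b \notin G -> unbounded (h2 0) b.
  by move=> /G1; exact: unbounded_history.
have G1_inf b : b \in G -> forall n, exists2 m, (n <= m)%N & b \in p1 m.
  by move=> /asboolPn ?; case: (split1 b).
have G2_inf b : b \in G -> forall n, exists2 m, (n <= m)%N & b \in p2 m.
  move=> /asboolPn nb; case: (split2 b) => // ub.
  by case: nb; apply: unbounded_history ub.
have [m mL] := to_Loc.
(* The bounds are crossed: on [G], [u2] must contain [w1] and [m] for [s1 ++ m] to fit into [u1],
   and symmetrically. *)
have [k1 k1P] := segment_join (fun b => cnt b w2 + cnt b m)%N 0 G1_inf.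
have [k2 k2P] := segment_join (fun b => cnt b w1 + cnt b m)%N 0 G2_inf.
have [lu1 eu1] := leads_segment 0 k1 hp1; have [lu2 eu2] := leads_segment 0 k2 hp2.
set u1 := segment _ _ _ in k1P lu1 eu1; set u2 := segment _ _ _ in k2P lu2 eu2.
rewrite add0n in lu1 eu1; rewrite add0n in lu2 eu2.
have [v1 lv1 v1P] := unbounded_join (fun b => cnt b w1 + cnt b u1 + cnt b m)%N (B := [predC G])
  G1.
have [v2 lv2 v2P] := unbounded_join (fun b => cnt b w2 + cnt b u2 + cnt b m)%N (B := [predC G])
  G2.
pose s1 := word_of [ffun b =>
  (cnt b w1 + cnt b u1 - (cnt b w2 + cnt b u2))%N : nat] : word N.
pose s2 := word_of [ffun b =>
  (cnt b w2 + cnt b u2 - (cnt b w1 + cnt b u1))%N : nat] : word N.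
pose s := word_of [ffun b =>
  minn (cnt b w1 + cnt b u1) (cnt b w2 + cnt b u2) : nat] : word N.
have r1C : component_of (exec (s1 ++ m) (h1 k1)) = C1.
  have lv : legal (u1 ++ v1) (h1 k1) by rewrite legal_cat lu1 eu1.
  rewrite -h1C (@leads_component _ _ _ (h1 0) (exec v1 (h1 0))); last by exists v1.
  rewrite -eu1 -exec_cat; apply: leads_component; apply: leads_removal => // b.
  rewrite !cnt_cat cnt_word_of ffunE; have [bG|bG] := boolP (b \in G).
    by have := k1P b bG; have := k2P b bG; lia.
  by have := v1P b bG; lia.
have r2C : component_of (exec (s2 ++ m) (h2 k2)) = C2.
  have lv : legal (u2 ++ v2) (h2 k2) by rewrite legal_cat lu2 eu2.
  rewrite -h2C (@leads_component _ _ _ (h2 0) (exec v2 (h2 0))); last by exists v2.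
  rewrite -eu2 -exec_cat; apply: leads_component; apply: leads_removal => // b.
  rewrite !cnt_cat cnt_word_of ffunE; have [bG|bG] := boolP (b \in G).
    by have := k1P b bG; have := k2P b bG; lia.
  by have := v2P b bG; lia.
rewrite -r1C -r2C; congr component_of.
apply: (@exec_inj_Loc s); rewrite ?internal_exec ?tw_cat ?mL //.
rewrite -!exec_cat.
have -> : exec ((s1 ++ m) ++ s) (h1 k1) = exec (u1 ++ w1 ++ m) (h1 k1).
  by apply/exec_perm/cnt_perm => b; rewrite !cnt_cat !cnt_word_of !ffunE; lia.
have -> : exec ((s2 ++ m) ++ s) (h2 k2) = exec (u2 ++ w2 ++ m) (h2 k2).
  by apply/exec_perm/cnt_perm => b; rewrite !cnt_cat !cnt_word_of !ffunE; lia.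
by rewrite !exec_cat eu1 eu2 e12.
Qed.

(** Starting far back and continuing with unbounded letters gives a legal word that fires every
    letter, which makes the chips nonnegative, and that contains [m], which makes the state locally
    recurrent. *)
Lemma recurrent_rep (C : component N) : recurrent C -> exists c,
  [/\ component_of c = C, internal c \in Loc N & forall b, 0 <= chips c b].
Proof.
move=> /recurrent_split[h [p [hp hC split_h]]].
pose G : {pred letter N} := [pred b | ~~ `[< unbounded (h 0) b >]].
have G1 b : b \notin G -> unbounded (h 0) b by rewrite negbK => /asboolP.
have G_inf b : b \in G -> forall n, exists2 m, (n <= m)%N & b \in p m.
  by move=> /asboolPn ?; case: (split_h b).
have [m mL] := to_Loc.
have [k kP] := segment_join (fun b => cnt b m + 1)%N 0 G_inf.
have [lu eu] := leads_segment 0 k hp; set u := segment _ _ _ in kP lu eu.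
have [v lv vP] := unbounded_join (fun b => cnt b m + 1)%N (B := [predC G]) G1.
have luv : legal (u ++ v) (h k) by rewrite legal_cat lu eu.
have le_uv b : (cnt b m + 1 <= cnt b (u ++ v))%N.
  by rewrite cnt_cat; have [/kP|/vP] := boolP (b \in G); lia.
exists (exec (u ++ v) (h k)); split=> [||b].
- by rewrite exec_cat eu -hC; apply/esym/leads_component; exists v.
- pose r := word_of [ffun b => (cnt b (u ++ v) - cnt b m)%N : nat] : word N.
  rewrite internal_exec (@tw_perm _ _ _ _ (r ++ m)) ?tw_cat ?mL // => b.
  by rewrite [in RHS]cnt_cat [cnt b r]cnt_word_of ffunE; have := le_uv b; lia.
- by apply: chips_fired => //; rewrite -cnt_gt0; have := le_uv b; lia.
Qed.

End Recurrent.

(** * Existence of recurrent components *)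

(* Let F be the union of the supports of all k >= 0 with k <= P k. On its
   complement G no such k is supported, so I - P_GG is invertible and the
   solution of k = P_GG k + 1 is positive. *)
Lemma nonneg_matrix_split (R : realFieldType) n (P : 'M[R]_n) :
  (forall i j, 0 <= P i j) ->
  exists kF kG : 'cV[R]_n, [/\ forall i, 0 <= kF i 0, forall i, 0 <= kG i 0,
    forall i, 0 < kF i 0 \/ 0 < kG i 0,
    forall i, kF i 0 <= (P *m kF) i 0
  & forall i, 0 < kG i 0 -> (P *m kG) i 0 <= kG i 0].
Proof.
move=> P_ge0.
pose sup (k : 'cV[R]_n) := (forall i, 0 <= k i 0) /\ (forall i, k i 0 <= (P *m k) i 0).
pose F : {pred 'I_n} := [pred i | `[< exists2 k, sup k & 0 < k i 0 >]].
have /choice[f fP] i : exists k, i \in F -> sup k /\ 0 < k i 0.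
  have [/asboolP[k ks ki]|_] := boolP (i \in F); last by exists 0.
  by exists k.
pose kF := \sum_(i in F) f i.
have kFE i : kF i 0 = \sum_(j in F) f j i 0 by rewrite summxE.
pose Q : 'M[R]_n := \matrix_(i, j) (if (i \notin F) && (j \notin F) then P i j else 0).
have Q_null (w : 'cV[R]_n) : (forall i, 0 <= w i 0) -> (forall i, w i 0 <= (Q *m w) i 0) -> w = 0.
  move=> w0 wQ; have wF i : i \in F -> w i 0 = 0.
    move=> iF; apply/le_anti; rewrite w0 andbT; apply: le_trans (wQ i) _.
    by rewrite mxE big1 // => j _; rewrite mxE iF mul0r.
  apply/colP => i; rewrite [RHS]mxE; have [/wF//|iF] := boolP (i \in F).
  apply/eqP; apply: contraNT iF => wi; apply/asboolP; exists w; last first.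
    by rewrite lt_neqAle eq_sym wi w0.
  split=> // l; apply: le_trans (wQ l) _; rewrite !mxE; apply: ler_sum => j _.
  by rewrite mxE; case: ifP => // _; rewrite mul0r mulr_ge0.
have Q_ge0 i j : 0 <= Q i j by rewrite mxE; case: ifP.
have unitQ : 1%:M - Q \in unitmx.
  rewrite -unitmx_tr unitmxE unitfE; apply/det0P => -[v v0 vQ].
  (* The absolute values of a kernel vector satisfy [w <= Q w], so [Q_null] applies. *)
  pose w : 'cV[R]_n := \col_i `|v 0 i|.
  have vE i : v 0 i = \sum_j Q i j * v 0 j.
    move: vQ => /rowP/(_ i); rewrite linearB /= trmx1 mulmxBr mulmx1 !mxE => /eqP.
    rewrite subr_eq0 => /eqP ->; apply: eq_bigr => j _; by rewrite mxE mulrC.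
  suff w0 : w = 0.
    case/eqP: v0; apply/rowP => i; move/colP: w0 => /(_ i); rewrite !mxE.
    by move/normr0P/eqP.
  apply: Q_null => i; rewrite !mxE // vE; apply: le_trans (ler_norm_sum _ _ _) _.
  by apply: ler_sum => j _; rewrite normrM [w _ _]mxE ger0_norm.
have [k kQ] : exists k : 'cV[R]_n, (1%:M - Q) *m k = const_mx 1.
  by exists (invmx (1%:M - Q) *m const_mx 1); rewrite mulmxA mulmxV // mul1mx.
have kE i : k i 0 = (Q *m k) i 0 + 1.
  move: kQ; rewrite mulmxBl mul1mx => /colP/(_ i).
  by rewrite [RHS]mxE [LHS]mxE [X in _ + X = _]mxE; lra.
have k_ge0 i : 0 <= k i 0.
  (* The negative part of [k] is at most its image under [Q], hence vanishes. *)
  suff /colP/(_ i) : (\col_i Num.max (- k i 0) 0 : 'cV[R]_n) = 0.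
    by rewrite !mxE => /eqP; rewrite eq_maxr; lra.
  apply: Q_null => {}i; rewrite !mxE; first by rewrite le_max lexx orbT.
  rewrite ge_max sumr_ge0 => [|j _]; last by rewrite mulr_ge0 // mxE le_max lexx orbT.
  rewrite andbT kE mxE opprD.
  apply: (@le_trans _ _ (- \sum_j Q i j * k j 0)); first by lra.
  rewrite -sumrN; apply: ler_sum => j _; rewrite [X in _ <= _ * X]mxE -mulrN ler_wpM2l //.
  by rewrite le_max lexx.
have k_gt0 i : 0 < k i 0.
  rewrite kE ltr_wpDl // mxE sumr_ge0 // => j _; exact: mulr_ge0.
exists kF, (\col_i if i \in F then 0 else k i 0); split=> i.
- by rewrite kFE sumr_ge0 // => j /fP[[]].
- by rewrite mxE; case: ifP.
- have [iF|iF] := boolP (i \in F); last by right; rewrite mxE (negbTE iF).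
  left; rewrite kFE (bigD1 i) //= ltr_pwDl //; first by have [] := fP _ iF.
  by rewrite sumr_ge0 // => j /andP[/fP[[]]].
- rewrite kFE /kF mulmx_sumr summxE; apply: ler_sum => j /fP[[_ h] _]; exact: h.
- rewrite [X in 0 < X]mxE; case: ifP => [|iF _]; first by rewrite ltxx.
  rewrite [leRHS]mxE iF kE; apply: (@le_trans _ _ ((Q *m k) i 0)); last by lra.
  rewrite !mxE; apply: ler_sum => j _; rewrite !mxE iF /=.
  by case: ifP => //=; rewrite ?mulr0 ?mul0r.
Qed.

Lemma rat_common_denominator (I : finType) (f : I -> rat) : (forall i, 0 <= f i) ->
  exists2 d : nat, (0 < d)%N & exists k : I -> nat, forall i, (k i)%:R = d%:R * f i.
Proof.
move=> f0; pose d := (\prod_i `|denq (f i)|)%N.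
have d_gt0 : (0 < d)%N by rewrite prodn_gt0 // => i; rewrite absz_gt0 denq_neq0.
exists d => //; suff h i : exists k : nat, k%:R = d%:R * f i by have /choice[k kP] := h; exists k.
pose r := (\prod_(j | j != i) `|denq (f j)|)%N.
have dE' : d = (`|denq (f i)| * r)%N by rewrite /d (bigD1 i).
exists (`|numq (f i)| * r)%N; rewrite dE' !natrM.
have dE : `|denq (f i)|%:R = (denq (f i))%:~R :> rat.
  by rewrite -[in RHS](gez0_abs (denq_ge0 _)).
have nE : `|numq (f i)|%:R = (numq (f i))%:~R :> rat.
  by rewrite -[in RHS](gez0_abs (_ : 0 <= numq (f i))) // numq_ge0.
rewrite dE nE -[X in _ * _ * X]divq_num_den mulrAC; congr (_ * _).
by rewrite mulrCA mulfV ?mulr1 // intr_eq0 denq_neq0.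
Qed.

Lemma edivn_succ n d : (0 < d)%N ->
  [/\ ((n %% d).+1 < d)%N, (n.+1 %% d = (n %% d).+1)%N & (n.+1 %/ d = n %/ d)%N] \/
  [/\ ((n %% d).+1 = d)%N, (n.+1 %% d = 0)%N & (n.+1 %/ d = (n %/ d).+1)%N].
Proof.
move=> d_gt0; have lt_n := ltn_pmod n d_gt0; rewrite divnS // modnS.
case: (boolP (d %| n.+1)%N) => [dn|ndn]; [right|left]; split=> //.
  have := dn; rewrite {1}(divn_eq n d) -addnS dvdn_addr ?dvdn_mull // => /dvdn_leq.
  by move=> /(_ isT); lia.
rewrite ltn_neqAle lt_n andbT; apply: contraNneq ndn => nd.
by rewrite (divn_eq n d) -addnS nd dvdn_addr ?dvdn_mull.
Qed.

Section Existence.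
Context (V : finType) (E : V -> V -> finType) (N : finite_abelian_network E).

Implicit Types (w u v : word N) (c d : config N) (a b : letter N) (q : states N).

Lemma leads_by_nth a0 w c c' i : leads_by w c c' -> (i < size w)%N ->
  leads_by [:: nth a0 w i] (exec (take i w) c) (exec (take i.+1 w) c).
Proof.
move=> [lw _] iw; rewrite (take_nth a0 iw) -cats1 exec_cat; split=> //.
move: lw; rewrite -{1}(cat_take_drop i.+1 w) legal_cat (take_nth a0 iw) -cats1.
by rewrite legal_cat => /andP[/andP[]].
Qed.

(** Time [n] is position [n %% size w] of pass [n %/ size w]; [a0] is the default of [nth]. *)
Lemma periodic_forward a0 w (D : nat -> config N) :
  (forall s, leads_by w (D s) (D s.+1)) ->
  exists (f : nat -> config N) (l : nat -> letter N), [/\ f 0%N = D 0%N,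
    w != [::] -> forall n, leads_by [:: l n] (f n) (f n.+1) &
    {in w, forall b n, exists2 m, (n <= m)%N & l m = b}].
Proof.
move=> hD; exists (fun n => exec (take (n %% size w) w) (D (n %/ size w)%N)).
exists (fun n => nth a0 w (n %% size w)%N); split.
- by rewrite mod0n div0n take0.
- rewrite -size_eq0 -lt0n => w_gt0 n; have lt_n := ltn_pmod n w_gt0.
  have := leads_by_nth a0 (hD (n %/ size w)%N) lt_n.
  have [[_ -> ->]|[sE -> ->]] := edivn_succ n w_gt0; first by [].
  by rewrite sE take_size take0; have [_ ->] := hD (n %/ size w)%N.
- move=> b bw n; exists (n * size w + index b w)%N.
    by rewrite (leq_trans _ (leq_addr _ _)) // leq_pmulr // -has_predT; apply/hasP; exists b.
  by rewrite modnMDl modn_small ?nth_index // index_mem.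
Qed.

Lemma periodic_backward a0 w (D : nat -> config N) :
  (forall s, leads_by w (D s.+1) (D s)) ->
  exists (f : nat -> config N) (l : nat -> letter N), [/\ f 0%N = D 0%N,
    w != [::] -> forall n, leads_by [:: l n] (f n.+1) (f n) &
    {in w, forall b n, exists2 m, (n <= m)%N & l m = b}].
Proof.
move=> hD.
(* Time runs backwards: [n %% size w] letters remain to be fired in the pass that starts at
   [D (n %/ size w).+1]. *)
exists (fun n => exec (take (size w - n %% size w) w) (D (n %/ size w).+1)%N).
exists (fun n => nth a0 w (size w - (n %% size w).+1)%N); split.
- by rewrite mod0n div0n subn0 take_size; have [_ ->] := hD 0%N.
- rewrite -size_eq0 -lt0n => w_gt0 n; have lt_n := ltn_pmod n w_gt0.
  have lt_m : (size w - (n %% size w).+1 < size w)%N by rewrite ltn_subrL w_gt0.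
  have := leads_by_nth a0 (hD (n %/ size w)%N) lt_m.
  rewrite subnSK //.
  have [[_ -> ->]|[sE -> ->]] := edivn_succ n w_gt0; first by [].
  by rewrite sE subnn take0 subn0 take_size; have [_ ->] := hD (n %/ size w).+1.
- move=> b bw n; exists (n * size w + (size w - (index b w).+1))%N.
    by rewrite (leq_trans _ (leq_addr _ _)) // leq_pmulr // -has_predT; apply/hasP; exists b.
  have := bw; rewrite -index_mem => ib.
  have i_lt : (size w - (index b w).+1 < size w)%N by rewrite ltn_subrL (leq_trans _ ib).
  by rewrite modnMDl modn_small // subnSK // subKn ?nth_index // ltnW.
Qed.

(** A future and a past are glued at [c0]; the flags [hf] and [hb] tell which halves exist, since a
    periodic word may be empty. *)
Lemma recurrent_intro c0 (cf cb : nat -> config N) (af ab : nat -> letter N)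
    (hf hb : bool) : letter N -> cf 0%N = c0 -> cb 0%N = c0 ->
  (hf -> forall n, leads_by [:: af n] (cf n) (cf n.+1)) ->
  (hb -> forall n, leads_by [:: ab n] (cb n.+1) (cb n)) ->
  (forall b, (hf /\ forall n, exists2 m, (n <= m)%N & af m = b) \/
             (hb /\ forall n, exists2 m, (n <= m)%N & ab m = b)) ->
  recurrent (component_of c0).
Proof.
move=> a0 cf0 cb0 stepf stepb hdiv.
pose I (i : int) := if 0 < i then hf else if i < 0 then hb else true.
pose c (i : int) := if 0 < i then cf `|i|%N else cb `|i|%N.
(* [a i] labels the step into [c i], hence the predecessor on the forward side. *)
pose a (i : int) := if 0 < i then af `|i|.-1%N else ab `|i|%N.
have cfE (n : nat) : c n = cf n.
  by rewrite /c; case: n => [|n] //=; rewrite cf0 cb0.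
have cbE (n : nat) : c (- n%:Z) = cb n.
  by rewrite /c abszN; case: ifP => //; lia.
exists I, c, a; split.
- split.
    have hfb : hf || hb by case: (hdiv a0) => -[-> _]; rewrite ?orbT.
    case: hf hb hfb @I {stepf stepb hdiv} => [] [] // _ I.
    + suff -> : I = (fun=> true) by constructor.
      by apply/funext => i; rewrite /I; case: ifP => // _; case: ifP.
    + suff -> : I = (fun i => 0 <= i) by constructor.
      by apply/funext => i; rewrite /I; case: (ltgtP i 0).
    + suff -> : I = (fun i => i <= 0) by constructor.
      by apply/funext => i; rewrite /I; case: (ltgtP i 0).
  move=> i; rewrite /I /a; have [i_gt0 _ hf1|i_le0] := ltP 0 i.
    have -> : i - 1 = `|i|.-1%N by lia.
    have -> : c i = cf `|i|.-1.+1 by rewrite -cfE; congr c; lia.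
    by rewrite cfE; exact: stepf.
  have -> : i - 1 = - `|i|.+1%:Z by lia.
  have -> : c i = cb `|i|%N by rewrite -cbE; congr c; lia.
  have neg : - `|i|.+1%:Z < 0 :> int by lia.
  by rewrite cbE neg (lt_gtF neg) => hb1 _; exact: stepb.
- move=> b n; have [[hf1 inf]|[hb1 inf]] := hdiv b.
    have [m nm <-] := inf n; exists m.+1%:Z; rewrite /I /a /=.
    by split=> //; lia.
  have [m nm <-] := inf n; exists (- m%:Z); rewrite /I /a hb1.
  have -> : (0 < - m%:Z) = false by lia.
  by rewrite abszN; split=> //; case: ifP.
- have compf n : hf -> component_of (cf n) = component_of c0.
    move=> hf1; elim: n => [|n <-]; first by rewrite cf0.
    by apply/esym/leads_component; exists [:: af n]; exact: stepf.
  have compb n : hb -> component_of (cb n) = component_of c0.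
    move=> hb1; elim: n => [|n <-]; first by rewrite cb0.
    by apply/leads_component; exists [:: ab n]; exact: stepb.
  move=> i; rewrite /I /c; case: ifP => // [_|i_le0]; first exact: compf.
  case: ifP => [_|i_ge0 _]; first exact: compb.
  have -> : i = 0 by lia.
  by rewrite cb0.
Qed.

Context (P : 'M[rat]_#|letter N|).
Context (irrN : locally_irreducible N) (prodP : is_production_matrix P).

(** The vectors of [nonneg_matrix_split] are made integral by the denominator [d], then multiplied
    by the orders [r] and [s] so that the words fix [q]. *)
Lemma balanced_words : exists (q : states N) (wF wG : word N),
  [/\ tw wF q = q, tw wG q = q, forall b, b \in wF \/ b \in wG,
      forall b, (cnt b wF <= sent wF q b)%N &
      {in wG, forall b, (sent wG q b <= cnt b wG)%N}].
Proof.
have P_ge0 i j : 0 <= P i j.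
  by have := coef_ge0 irrN prodP (enum_val i) (enum_val j); rewrite /coef !enum_valK.
have [kF [kG [F0 G0 FG FP GP]]] := nonneg_matrix_split P_ge0.
pose f (x : letter N + letter N) := match x with
  | inl a => kF (enum_rank a) 0 | inr a => kG (enum_rank a) 0 end.
have [|d d_gt0 [k kE]] := @rat_common_denominator _ f; first by case=> a; [exact: F0|exact: G0].
have [q qL] := Loc_ex N.
pose nF : vecN N := [ffun a => k (inl a)]; pose nG : vecN N := [ffun a => k (inr a)].
have [r r_gt0 hr] := tn_order nF; have [s s_gt0 hs] := tn_order nG.
pose wF := word_of (nF *+ r); pose wG := word_of (nG *+ s).
have wFq : tw wF q = q by exact: hr.
have wGq : tw wG q = q by exact: hs.
have natMn (m n : nat) : m *+ n = (n * m)%N by rewrite -mulr_natl natn.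
have cntF a : (cnt a wF)%:R = (r * d)%:R * kF (enum_rank a) 0.
  by rewrite cnt_word_of ffunMnE ffunE natMn !natrM kE /= mulrA.
have cntG a : (cnt a wG)%:R = (s * d)%:R * kG (enum_rank a) 0.
  by rewrite cnt_word_of ffunMnE ffunE natMn !natrM kE /= mulrA.
have prodE (kk : 'cV[rat]_#|letter N|) (m : nat) b :
    produced P (fun a => m%:R * kk (enum_rank a) 0) b = m%:R * (P *m kk) (enum_rank b) 0.
  rewrite mxE (reindex enum_rank) /=; last exact/onW_bij/enum_rank_bij.
  by rewrite mulr_sumr; apply: eq_bigr => a _; rewrite /coef mulrCA.
have rd_gt0 : 0 < (r * d)%:R :> rat by rewrite ltr0n muln_gt0 r_gt0.
have sd_gt0 : 0 < (s * d)%:R :> rat by rewrite ltr0n muln_gt0 s_gt0.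
have memF b : (b \in wF) = (0 < kF (enum_rank b) 0).
  by rewrite -cnt_gt0 -(ltr0n rat) cntF pmulr_rgt0.
have memG b : (b \in wG) = (0 < kG (enum_rank b) 0).
  by rewrite -cnt_gt0 -(ltr0n rat) cntG pmulr_rgt0.
exists q, wF, wG; split=> // b; rewrite ?memF ?memG //.
- rewrite -(ler_nat rat) (sent_cycle irrN prodP) //.
  by under [fun a => _]funext do rewrite cntF; rewrite cntF prodE ler_pM2l.
- move=> bG; rewrite -(ler_nat rat) (sent_cycle irrN prodP) //.
  by under [fun a => _]funext do rewrite cntG; rewrite cntG prodE ler_pM2l // GP.
Qed.

Lemma recurrent_exists : letter N -> exists C : component N, recurrent C.
Proof.
move=> a0; have [q [wF [wG [wFq wGq FG leF leG]]]] := balanced_words.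
(* [D s] lies [s] passes of [wF] in the future and [B s] lies [s] passes of [wG] in the past. The
   initial chips pay for every pass, because away from time 0 the letters of the repeated word never
   have fewer chips. *)
pose D s : config N := ([ffun b => (cnt b wF + cnt b wG)%N%:Z +
  s%:Z * ((sent wF q b)%:Z - (cnt b wF)%:Z)], q).
pose B s : config N := ([ffun b => (cnt b wF + cnt b wG)%N%:Z +
  s%:Z * ((cnt b wG)%:Z - (sent wG q b)%:Z)], q).
have chD s b : chips (D s) b = (cnt b wF + cnt b wG)%N%:Z +
    s%:Z * ((sent wF q b)%:Z - (cnt b wF)%:Z) by rewrite /chips ffunE.
have chB s b : chips (B s) b = (cnt b wF + cnt b wG)%N%:Z +
    s%:Z * ((cnt b wG)%:Z - (sent wG q b)%:Z) by rewrite /chips ffunE.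
have DB0 : D 0%N = B 0%N by apply: config_eq => // b; rewrite chD chB !mul0r.
have stepD s : leads_by wF (D s) (D s.+1).
  split; last first.
    apply: config_eq => [b|]; last by rewrite internal_exec.
    by rewrite chips_exec !chD -[internal _]/q intS; ring.
  by apply: legal_of_le => b _; rewrite chD; have := leF b; nia.
have stepB s : leads_by wG (B s.+1) (B s).
  split; last first.
    apply: config_eq => [b|]; last by rewrite internal_exec.
    by rewrite chips_exec !chB -[internal _]/q intS; ring.
  by apply: legal_of_le => b /leG; rewrite chB; nia.
have [cf [af [cf0 stepf inff]]] := periodic_forward a0 stepD.
have [cb [ab [cb0 stepb infb]]] := periodic_backward a0 stepB.
exists (component_of (D 0%N)).
apply: (recurrent_intro (hf := wF != [::]) (hb := wG != [::]) a0 cf0 _ stepf stepb).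
  by rewrite cb0 DB0.
move=> b; have [bF|bG] := FG b; [left|right]; split.
- by case: wF bF {stepD D chD DB0 wFq FG leF leG chB B stepB stepf stepb inff infb cf0 cb0}.
- exact: inff.
- by case: wG bG {stepD D chD DB0 wGq FG leF leG chB B stepB stepf stepb inff infb cf0 cb0}.
- exact: infb.
Qed.

End Existence.

(** * The Grothendieck group and its torsion *)

Section Isomorphism.
Context (V : finType) (E : V -> V -> finType) (N : finite_abelian_network E).
Context (P : 'M[rat]_#|letter N|).
Context (irrN : locally_irreducible N) (prodP : is_production_matrix P).

Implicit Types (w u v : word N) (c d : config N) (a b : letter N) (q : states N).
Implicit Types (m n : vecN N) (z : vecZ N) (C : rec_component N).

Lemma chips_shift n c b : chips (shift_config n c) b = chips c b + (n b)%:Z.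
Proof. by rewrite /chips !ffunE. Qed.

Lemma internal_shift n c : internal (shift_config n c) = internal c.
Proof. by []. Qed.

Lemma exec_shift n w c : exec w (shift_config n c) = shift_config n (exec w c).
Proof. by elim: w c => //= a w IH c; rewrite fire_shift IH. Qed.

Lemma shift_config_inj n : injective (@shift_config _ _ N n).
Proof.
move=> c d e; apply: config_eq => [b|].
  have : chips (shift_config n c) b = chips (shift_config n d) b by rewrite e.
  by rewrite !chips_shift => /addIr.
by have : internal (shift_config n c) = internal (shift_config n d) by rewrite e.
Qed.

Lemma component_of_repr (C : component N) : component_of (repr C) = C.
Proof. exact: reprK. Qed.

Lemma rec_componentP C : recurrent (val C).
Proof. exact/asboolP/(valP C). Qed.

Lemma phi_component n C c :
  component_of c = val C -> val (phi n C) = component_of (shift_config n c).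
Proof. by move=> cC; rewrite /= -cC shift_component_of. Qed.

Lemma phi_phi m n C : phi m (phi n C) = phi (m + n) C.
Proof. by rewrite phiD. Qed.

(** [exec] commutes with the injective shift, so a meeting of the shifted components unshifts to a
    meeting by possibly illegal words, as [recurrent_quasi] accepts. *)
Lemma phi_inj n : injective (@phi _ _ N n).
Proof.
move=> C1 C2 /(congr1 val) /=.
move=> /component_ofP[d [[w [_ e]] [w' [_ e']]]]; apply: val_inj.
apply: (recurrent_quasi irrN prodP (rec_componentP C1) (rec_componentP C2)
  (component_of_repr _) (component_of_repr _)).
by exists w, w'; apply: (@shift_config_inj n); rewrite -!exec_shift e e'.
Qed.

Lemma image_kernelE (z k : vecZ N) : to_col z = (1%:M - P) *m to_col k <->
  forall b, (z b)%:~R = (k b)%:~R - produced P (fun a => (k a)%:~R) b :> rat.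
Proof.
rewrite mulmxBl mul1mx; split=> [/colP e b|e].
  have := e (enum_rank b); rewrite [RHS]mxE [X in _ = _ + X]mxE mulmx_to_col.
  by rewrite !mxE enum_rankK.
apply/colP => i; rewrite -[i]enum_valK [RHS]mxE [X in _ = _ + X]mxE mulmx_to_col.
by rewrite !mxE enum_rankK.
Qed.

Lemma tw_eq_produced w w' q (k : vecZ N) b : tw w q = tw w' q ->
  (forall a, k a = (cnt a w)%:Z - (cnt a w')%:Z) ->
  produced P (fun a => (k a)%:~R) b = ((sent w q b)%:Z - (sent w' q b)%:Z)%:~R.
Proof.
move=> /(tw_eq_kernel irrN prodP)[_ flow] kE; rewrite rmorphB [RHS]flow.
by congr produced; apply/funext => a; rewrite kE rmorphB.
Qed.

(** Words [w] and [w'] to a common configuration act alike on the state, so their difference [k] is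
    in the kernel; comparing chips where they meet gives [m - n = k - P k]. *)
Lemma phi_eq_image_kernel m n C : phi m C = phi n C ->
  to_vecZ m - to_vecZ n \in image_kernel P.
Proof.
move=> /(congr1 val); rewrite !(phi_component _ (component_of_repr _)).
set c := repr (val C).
move=> /component_ofP[d [[w [_ e]] [w' [_ e']]]].
rewrite -{}e' in e.
have eq_tw : tw w (internal c) = tw w' (internal c).
  by have := congr1 (@internal _ _ N) e; rewrite !internal_exec.
pose k := to_vecZ (parikh w) - to_vecZ (parikh w').
have kE a : k a = (cnt a w)%:Z - (cnt a w')%:Z by rewrite !ffunE.
apply/asboolP; exists k; first by have [] := tw_eq_kernel irrN prodP eq_tw.
apply/image_kernelE => b; rewrite (tw_eq_produced _ eq_tw kE) -rmorphB /=.
congr (_%:~R); rewrite kE !ffunE.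
have : chips (exec w (shift_config m c)) b = chips (exec w' (shift_config n c)) b by rewrite e.
by rewrite !chips_exec !chips_shift !internal_shift; lia.
Qed.

(* Every recurrent component has a representative with nonnegative chips and a
   locally recurrent state; adding k^+ + k^- chips makes both k^+ and k^- legal,
   and both lead to the same configuration. *)
Lemma image_kernel_phi m n : to_vecZ m - to_vecZ n \in image_kernel P ->
  exists s, forall C, phi (s + m) C = phi (s + n) C.
Proof.
move=> /asboolP[k kK kE]; exists (pos_part k + neg_part k) => C.
set s := pos_part k + neg_part k.
have [c [cC cL c_ge0]] := recurrent_rep (rec_componentP C).
apply: val_inj; rewrite !(phi_component _ cC).
have eq_tw : tw (word_of (pos_part k)) (internal c) = tw (word_of (neg_part k)) (internal c).
  by move/total_kernelP: kK => /(_ _ cL).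
have addE l b : (s + l) b = (pos_part k b + neg_part k b + l b)%N by rewrite !ffunE.
apply/component_ofP; exists (exec (word_of (pos_part k)) (shift_config (s + m) c)); split.
  exists (word_of (pos_part k)); split=> //; apply: legal_of_le => b _.
  by rewrite cnt_word_of chips_shift addE; have := c_ge0 b; lia.
exists (word_of (neg_part k)); split.
  apply: legal_of_le => b _.
  by rewrite cnt_word_of chips_shift addE; have := c_ge0 b; lia.
apply: config_eq => [b|]; last by rewrite !internal_exec.
rewrite !chips_exec !chips_shift !internal_shift !cnt_word_of !addE.
have kpn a : k a = (cnt a (word_of (pos_part k)))%:Z - (cnt a (word_of (neg_part k)))%:Z.
  by rewrite !cnt_word_of !ffunE; lia.
have /image_kernelE/(_ b) := kE; rewrite (tw_eq_produced _ eq_tw kpn) -rmorphB /=.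
have -> : (to_vecZ m - to_vecZ n) b = (m b)%:Z - (n b)%:Z by rewrite !ffunE.
move=> /intr_inj; rewrite kpn !cnt_word_of.
move: (m b) (n b) (chips c b) (pos_part k b) (neg_part k b).
move: (sent (word_of (pos_part k)) _ b) (sent (word_of (neg_part k)) _ b); lia.
Qed.

Lemma shift_monoid_ofD m n :
  shift_monoid_of (m + n) = shift_monoid_of m + shift_monoid_of n :> shift_monoid N.
Proof. by apply: val_inj; rewrite /= phiD. Qed.

Lemma shift_monoid_ofE (x : shift_monoid N) : exists n, x = shift_monoid_of n.
Proof. by case: x => f /= fM; have /asboolP[n fE] := fM; exists n; exact: val_inj. Qed.

Lemma groth_shift_eq m m' n n' :
  groth_class (shift_monoid_of m, shift_monoid_of m') =
  groth_class (shift_monoid_of n, shift_monoid_of n') :> shift_groth N <->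
  exists s, phi (s + m + n') = phi (s + m' + n).
Proof.
split=> [/groth_classP[x /= e]|[s e]].
  have [s xE] := shift_monoid_ofE x; exists s; move: e.
  by rewrite xE -!shift_monoid_ofD => /(congr1 val).
apply/groth_classP; exists (shift_monoid_of s) => /=.
by rewrite -!shift_monoid_ofD; exact: val_inj.
Qed.

Definition groth_of_vec z : shift_groth N :=
  groth_class (shift_monoid_of (pos_part z), shift_monoid_of (neg_part z)).

Lemma groth_of_vecE m n :
  groth_class (shift_monoid_of m, shift_monoid_of n) = groth_of_vec (to_vecZ m - to_vecZ n).
Proof.
apply/groth_shift_eq; exists 0; congr phi; rewrite !add0r.
by apply/ffunP => a; rewrite !ffunE /=; lia.
Qed.

Lemma groth_of_vecB z z' : groth_of_vec (z - z') = groth_of_vec z - groth_of_vec z'.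
Proof.
apply/esym/(etrans (congr1 (groth_add _) (groth_oppE _)))/(etrans (groth_addE _ _)).
rewrite /= -!shift_monoid_ofD groth_of_vecE; congr groth_of_vec.
by apply/ffunP => a; rewrite !ffunE /=; lia.
Qed.

Lemma groth_of_vec_image_kernel z z' :
  groth_of_vec z = groth_of_vec z' <-> z - z' \in image_kernel P.
Proof.
have zz'E : z - z' = to_vecZ (pos_part z + neg_part z') - to_vecZ (neg_part z + pos_part z').
  by apply/ffunP => a; rewrite !ffunE /=; lia.
split=> [/groth_shift_eq[s e]|].
  (* Without letters there is only one vector. Otherwise the equality of maps is evaluated at a
     recurrent component; if none existed, all [phi n] would coincide. *)
  have [/existsP[a0 _]|/existsPn no_letter] := boolP [exists a : letter N, true]; last first.
    have -> : z = z' by apply/ffunP => a; have := no_letter a.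
    by rewrite subrr rpred0.
  have [C CR] := recurrent_exists irrN prodP a0.
  have := congr1 (@^~ (exist _ C (asboolT CR) : rec_component N)) e.
  rewrite -!addrA => /phi_eq_image_kernel; rewrite zz'E !to_vecZD opprD addrACA subrr add0r.
  by rewrite -!to_vecZD.
rewrite zz'E => /image_kernel_phi[s hs]; apply/groth_shift_eq; exists s.
by rewrite -!addrA; apply/funext.
Qed.

Definition quotient_to_groth (x : quotient_group P) : shift_groth N :=
  groth_of_vec (repr x).

Lemma quotient_to_groth_pi z : quotient_to_groth (\pi_(quotient_group P) z) = groth_of_vec z.
Proof.
apply/groth_of_vec_image_kernel; rewrite Quotient.idealrBE.
by apply/eqP; rewrite reprK.
Qed.

Lemma quotient_to_groth_is_zmod_morphism : zmod_morphism quotient_to_groth.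
Proof.
move=> x y; rewrite -[x]reprK -[y]reprK -raddfB !quotient_to_groth_pi.
exact: groth_of_vecB.
Qed.

HB.instance Definition _ := GRing.isZmodMorphism.Build _ _ quotient_to_groth
  quotient_to_groth_is_zmod_morphism.

Lemma groth_pair (g : shift_groth N) : exists mn : vecN N * vecN N,
  g = groth_class (shift_monoid_of mn.1, shift_monoid_of mn.2).
Proof.
rewrite -[g]groth_classK; case: (repr g) => x y.
have [m ->] := shift_monoid_ofE x; have [n ->] := shift_monoid_ofE y.
by exists (m, n).
Qed.

Lemma quotient_to_groth_bij : bijective quotient_to_groth.
Proof.
have /choice[r rE] := groth_pair.
exists (fun g => \pi_(quotient_group P) (to_vecZ (r g).1 - to_vecZ (r g).2)) => [x|g]; last first.
  by rewrite quotient_to_groth_pi -groth_of_vecE -rE.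
rewrite -[RHS]reprK; apply/eqP; rewrite -Quotient.idealrBE.
by apply/groth_of_vec_image_kernel; rewrite -groth_of_vecE -rE.
Qed.

(** By injectivity of the shifts, one pair representing [g] decides the relation for all pairs. *)
Lemma translates_intro (g : Tor N) C C' m n :
  val g = groth_class (shift_monoid_of m, shift_monoid_of n) ->
  phi m C = phi n C' -> translates g C C'.
Proof.
move=> gE mn m' n'; rewrite gE => /groth_shift_eq[s e]; apply: (@phi_inj (s + n)).
have eC : phi (s + m + n') C = phi (s + n + m') C by rewrite e.
by rewrite !phi_phi -eC [s + m + n']addrAC -(phi_phi (s + n') m) mn phi_phi addrAC.
Qed.

Lemma translates_unique (g : Tor N) C C1 C2 :
  translates g C C1 -> translates g C C2 -> C1 = C2.
Proof.
have [[m n] gE] := groth_pair (val g) => h1 h2.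
by apply: (@phi_inj n); rewrite -(h1 _ _ gE) -(h2 _ _ gE).
Qed.

Lemma translates_add (g h : Tor N) C1 C2 C3 :
  translates g C2 C3 -> translates h C1 C2 -> translates (g + h) C1 C3.
Proof.
have [[m n] gE] := groth_pair (val g); have [[m' n'] hE] := groth_pair (val h).
move=> /(_ _ _ gE) e /(_ _ _ hE) e'.
apply: (@translates_intro _ _ _ (m + m') (n + n')).
  have -> : val (g + h) = val g + val h by [].
  by rewrite gE hE !shift_monoid_ofD; exact: groth_addE.
by rewrite -(phi_phi m m') e' phi_phi addrC -(phi_phi n' m) e phi_phi addrC.
Qed.

Lemma translates0 C : translates (0 : Tor N) C C.
Proof.
apply: (@translates_intro _ _ _ 0 0) => //=.
Qed.

Lemma translates_sub (g h : Tor N) C1 C2 C3 :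
  translates (g + h) C1 C3 -> translates h C1 C2 -> translates g C2 C3.
Proof.
have [[m n] gE] := groth_pair (val g); have [[m' n'] hE] := groth_pair (val h).
move=> e3 /(_ _ _ hE) /= e2; apply: (@translates_intro _ _ _ m n gE).
apply: (@phi_inj n'); rewrite !phi_phi [n' + m]addrC -(phi_phi m n') -e2 phi_phi.
rewrite [n' + n]addrC; apply: e3; have -> : val (g + h) = val g + val h by [].
by rewrite gE hE !shift_monoid_ofD; exact: groth_addE.
Qed.

(** Agreement at a single component already puts the difference of the representing vectors into
    [(I - P)K]. *)
Lemma translates_free (g h : Tor N) C D : translates g C D -> translates h C D -> g = h.
Proof.
have [[m n] gE] := groth_pair (val g); have [[m' n'] hE] := groth_pair (val h).
move=> /(_ _ _ gE) /= e /(_ _ _ hE) /= e'; apply: val_inj => /=.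
rewrite gE hE /= !groth_of_vecE; apply/groth_of_vec_image_kernel.
have -> : to_vecZ m - to_vecZ n - (to_vecZ m' - to_vecZ n') = to_vecZ (n' + m) - to_vecZ (n + m').
  by apply/ffunP => a; rewrite !ffunE /=; lia.
by apply: (@phi_eq_image_kernel _ _ C); rewrite -!phi_phi e e' !phi_phi addrC.
Qed.

(** [h] sends [D] where [h + g] sends [C]. *)
Lemma translates_invertible (g : Tor N) C D : invertible C -> translates g C D -> invertible D.
Proof.
by move=> Cinv gCD h; have [D' hgCD'] := Cinv (h + g); exists D'; exact: translates_sub gCD.
Qed.

(** Choice turns [translates] into a function on invertible components; uniqueness of translates
    yields the action laws, and injectivity of [f] transfers freeness from [Tor N]. *)
Lemma torsion_action (G : zmodType) (f : {additive G -> shift_groth N}) : injective f ->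
  exists act : torsion_subgroup G -> invertible_component N -> invertible_component N,
    [/\ forall g (C : invertible_component N),
          unique (translates (torsion_map f g) (val C)) (val (act g C)),
        is_action act
      & is_free_action act].
Proof.
move=> f_inj; pose tf := torsion_map f.
have tfD g h : tf (g + h) = tf g + tf h by apply: val_inj; rewrite /= raddfD.
have tf0 : tf 0 = 0 by apply: val_inj; rewrite /= raddf0.
have tf_inj : injective tf by move=> g h [/f_inj]; exact: val_inj.
have /choice[act actP] (x : torsion_subgroup G * invertible_component N) :
    exists D : invertible_component N, translates (tf x.1) (val x.2) (val D).
  case: x => g C /=; have /asboolP Cinv := valP C; have [D gCD] := Cinv (tf g).
  by exists (exist _ D (asboolT (translates_invertible Cinv gCD))).
exists (fun g x => act (g, x)); split.
- move=> g C; split; first exact: (actP (g, C)).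
  by move=> D; exact: (translates_unique (actP (g, C))).
- split=> [C|g h C]; apply: val_inj.
    by apply: translates_unique (actP (0, C)) _; rewrite /= tf0; exact: translates0.
  apply: translates_unique (actP (g + h, C)) _; rewrite /= tfD.
  exact: translates_add (actP (g, act (h, C))) (actP (h, C)).
- move=> g h C e; apply: tf_inj; apply: translates_free (actP (g, C)) _.
  by rewrite e; exact: actP (h, C).
Qed.

Definition quotient_iso : {additive quotient_group P -> shift_groth N} := quotient_to_groth.

End Isomorphism.

Theorem theorem1p1 (V : finType) (E : V -> V -> finType)
    (N : finite_abelian_network E) (P : 'M[rat]_#|letter N|)
    (irrN : locally_irreducible N) (prodP : is_production_matrix P) :
  exists f : {additive quotient_group P -> shift_groth N},
    bijective f /\
    exists act : torsion_subgroup (quotient_group P) ->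
                 invertible_component N -> invertible_component N,
      [/\ forall g C,
            unique (translates (torsion_map f g) (val C)) (val (act g C)),
          is_action act
        & is_free_action act].
Proof.
have f_bij := quotient_to_groth_bij irrN prodP.
exists (quotient_iso irrN prodP); split=> //.
by apply: (torsion_action irrN prodP); exact: bij_inj.
Qed.
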